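(* Let $G$ be a finite simple $2$-connected graph. If $G$ is $\{K_{1,3},W\}$-heavy, then $G$ is Hamiltonian.
   Context: Let $G$ be a graph on $n$ vertices. An induced subgraph $H'$ of $G$ is called heavy if there exist two nonadjacent vertices in $H'$ whose degree sum in $G$ is at least $n$. For a graph $H$, $G$ is $H$-heavy if every induced subgraph of $G$ isomorphic to $H$ is heavy; for a family $\mathcal{H}$ of graphs, $G$ is $\mathcal{H}$-heavy if it is $H$-heavy for every $H\in\mathcal{H}$. $K_{1,3}$ is the claw (a star with three leaves). $W$ (the ''wounded'') is the graph on 6 vertices obtained from a triangle $abc$ by attaching a pendant edge $aa'$ at $a$ and a pendant path $bb'b''$ of length $2$ at $b$ (the vertex $c$ has degree $2$). *)

(* Defs.v *)
From mathcomp Require Import all_boot.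
Set Implicit Arguments.
Unset Strict Implicit.
Unset Printing Implicit Defensive.

Record sgraph := SGraph {
  vertex :> finType;
  adj : rel vertex;
  adj_sym : symmetric adj;
  adj_irrefl : irreflexive adj }.

Definition degree (G : sgraph) (x : G) : nat := #|[set y | adj x y]|.

Section Induced.
Variables (G : sgraph) (S : {set G}).

Definition induced_adj : rel {x : G | x \in S} :=
  fun u v => adj (val u) (val v).

Lemma induced_adj_sym : symmetric induced_adj.
Proof. by move=> u v; apply: adj_sym. Qed.

Lemma induced_adj_irrefl : irreflexive induced_adj.
Proof. by move=> u; apply: adj_irrefl. Qed.

Definition induced : sgraph := SGraph induced_adj_sym induced_adj_irrefl.
End Induced.

Definition isomorphic (G H : sgraph) : Prop :=
  exists2 f : G -> H, bijective f & forall x y, adj (f x) (f y) = adj x y.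

Definition connected (G : sgraph) : Prop :=
  0 < #|G| /\ forall x y : G, connect (@adj G) x y.

Definition k_connected (k : nat) (G : sgraph) : Prop :=
  k < #|G| /\ forall X : {set G}, #|X| < k -> connected (induced (~: X)).

(* [ucycle] also accepts sequences of length at most 2 (e.g. [:: x; y] for an
   edge xy), which are not cycles of a simple graph. *)
Definition hamiltonian (G : sgraph) : Prop :=
  exists c : seq G, [/\ 2 < size c, ucycle (@adj G) c & forall x, x \in c].

(* The degrees are those in G, not in the subgraph induced by S. *)
Definition heavy (G : sgraph) (S : {set G}) : Prop :=
  exists u v : G, [/\ u \in S, v \in S, u != v, ~~ adj u v
                    & #|G| <= degree u + degree v].

Definition graph_heavy (H G : sgraph) : Prop :=
  forall S : {set G}, isomorphic (induced S) H -> heavy S.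

Definition family_heavy (F : sgraph -> Prop) (G : sgraph) : Prop :=
  forall H, F H -> graph_heavy H G.

Section EdgeList.
Variables (n : nat) (s : seq (nat * nat)).

Definition edge_list_adj : rel 'I_n := fun i j =>
  (i != j) && (((val i, val j) \in s) || ((val j, val i) \in s)).

Lemma edge_list_adj_sym : symmetric edge_list_adj.
Proof. by move=> i j; rewrite /edge_list_adj eq_sym orbC. Qed.

Lemma edge_list_adj_irrefl : irreflexive edge_list_adj.
Proof. by move=> i; rewrite /edge_list_adj eqxx. Qed.

Definition edge_list_graph : sgraph :=
  SGraph edge_list_adj_sym edge_list_adj_irrefl.
End EdgeList.

Definition claw : sgraph := edge_list_graph 4 [:: (0, 1); (0, 2); (0, 3)].

(* a, b, c, a', b', b'' are numbered 0, 1, 2, 3, 4, 5. *)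
Definition wounded : sgraph :=
  edge_list_graph 6 [:: (0, 1); (0, 2); (1, 2); (0, 3); (1, 4); (4, 5)].

Definition claw_or_wounded (H : sgraph) : Prop := H = claw \/ H = wounded.

(* Main.v *)
Require Import Defs.
From mathcomp Require Import all_boot.
From mathcomp Require Import zify.
From Stdlib Require Import Classical.
Set Implicit Arguments.
Unset Strict Implicit.
Unset Printing Implicit Defensive.

(* Call two vertices o-adjacent if they are adjacent, or nonadjacent with degree
   sum at least the order of G.  By Ore's exchange a cycle of o-adjacent vertices
   never has more vertices than a longest cycle C.

   Suppose C misses a vertex.  A shortest path u Z v outside C splits C into
   strands A and B from u to v.  Around u a set of consecutive vertices of C (a
   hub) is grown along A and B: the next vertex of a strand is added as soon as it
   is o-adjacent to a vertex of the hub other than the current end of the strand.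
   Such a hub can be covered by two paths prescribing which exits are joined and
   where a given vertex is left free, so an o-adjacency between two free vertices
   in the hubs of u and v would close a longer cycle.  Hence if both hubs contained
   a nonadjacent pair with degree sum at least n, the two sums would contradict
   each other: the growth at one end, say u, only meets true adjacencies.  When it
   stops, the claws and the wounded graphs force the distance levels from Z inside
   the hub to be cliques joined completely to each other, and the exit that lies on
   the lower level yields a wounded graph that is not heavy. *)

Section Walks.
Variables (T : eqType) (r : rel T).
Hypothesis r_sym : symmetric r.

Definition walk x s y := exists l, [/\ s = x :: l, path r x l & last x l = y].

Lemma walk1 x : walk x [:: x] x.
Proof. by exists [::]. Qed.

Lemma path_rev x s y : path r x (rcons s y) = path r y (rcons (rev s) x).
Proof.
rewrite -rev_cons -[in RHS](last_rcons x s y).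
have -> : rev (x :: s) = rev (belast x (rcons s y)).
  by congr rev; elim: s x => //= a s IHs x; rewrite -IHs.
rewrite rev_path; apply: eq_path => a b; exact: r_sym.
Qed.

Lemma walk_rev x s y : walk x s y -> walk y (rev s) x.
Proof.
move=> [l [-> p lst]]; case: (lastP l) p lst => [|l' z] p /=; first by move=> <-; exact: walk1.
rewrite last_rcons => <-; exists (rcons (rev l') x); split.
- by rewrite rev_cons rev_rcons.
- by rewrite -path_rev.
- by rewrite last_rcons.
Qed.

Lemma walk_link x s y m z s' w :
  walk x s y -> path r y (rcons m z) -> walk z s' w -> walk x (s ++ m ++ s') w.
Proof.
move=> [l [-> pl ly]] pm [l' [-> pl' lw]]; exists (l ++ m ++ z :: l'); split => //.
  by rewrite cat_path pl ly -cat_rcons cat_path pm last_rcons.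
by rewrite !last_cat /=.
Qed.

Lemma walk_cat x s y z s' w :
  walk x s y -> r y z -> walk z s' w -> walk x (s ++ s') w.
Proof. by move=> ws ryz; apply: (walk_link (m := [::]) ws); rewrite /= ryz. Qed.

Lemma walk_rcons x s y z : walk x s y -> r y z -> walk x (rcons s z) z.
Proof. by move=> ws ryz; rewrite -cats1; apply: walk_cat ws ryz (walk1 z). Qed.

Lemma walk_uncat x s a b s' y : walk x (rcons s a ++ b :: s') y ->
  [/\ walk x (rcons s a) a, r a b & walk b (b :: s') y].
Proof.
move=> [l [e pl ly]].
case: s e => [|z s] /= [xE lE]; subst x l; move: pl ly => /=.
  by case/andP=> ab pl ly; split=> //; [exact: walk1 | exists s'].
rewrite cat_rcons cat_path last_cat /= => /and4P[ps za ab ps'] ly.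
split=> //; last by exists s'.
by exists (rcons s a); rewrite rcons_path ps za last_rcons.
Qed.

Lemma walk_cycle x s y m :
  walk x s y -> path r y (rcons m x) -> cycle r (s ++ m).
Proof.
move=> [l [-> pl ly]] pm.
by rewrite /= rcons_cat cat_path pl ly.
Qed.

Lemma path_split x s y t z :
  path r x (rcons (s ++ y :: t) z) = path r x (rcons s y) && path r y (rcons t z).
Proof. by rewrite -cat_rcons rcons_cat cat_path last_rcons. Qed.

Definition pcover (S : seq T) x y := exists s, perm_eq s S /\ walk x s y.

Definition pcover2 (S : seq T) x y x' y' :=
  exists s s', [/\ perm_eq (s ++ s') S, walk x s y & walk x' s' y'].

Lemma pcover_sym S x y : pcover S x y -> pcover S y x.
Proof.
move=> [s [sS ws]]; exists (rev s); split; last exact: walk_rev.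
by rewrite perm_rev.
Qed.

Lemma pcover2_flip S x y x' y' : pcover2 S x y x' y' -> pcover2 S x' y' x y.
Proof.
by move=> [s [s' [sS ws ws']]]; exists s', s; split=> //; rewrite perm_catC.
Qed.

Lemma pcover2_sym S x y x' y' : pcover2 S x y x' y' -> pcover2 S y x x' y'.
Proof.
move=> [s [s' [sS ws ws']]]; exists (rev s), s'; split => //; last exact: walk_rev.
by apply: (perm_trans _ sS); rewrite perm_cat2r perm_rev.
Qed.

Lemma pcover_perm S S' x y : perm_eq S S' -> pcover S x y -> pcover S' x y.
Proof.
by move=> SS' [s [sS ws]]; exists s; split=> //; apply: perm_trans sS SS'.
Qed.

Lemma pcover2_perm S S' x y x' y' :
  perm_eq S S' -> pcover2 S x y x' y' -> pcover2 S' x y x' y'.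
Proof.
by move=> SS' [s [s' [sS ? ?]]]; exists s, s'; split=> //; apply: perm_trans sS SS'.
Qed.

Lemma pcover_add S x y z : pcover S x y -> r y z -> pcover (z :: S) x z.
Proof.
move=> [s [sS ws]] ryz; exists (rcons s z); split; last exact: walk_rcons ws ryz.
by rewrite perm_rcons perm_cons.
Qed.

Lemma pcover2_add S x y x' y' z :
  pcover2 S x y x' y' -> r y' z -> pcover2 (z :: S) x y x' z.
Proof.
move=> [s [s' [sS ws ws']]] rz; exists s, (rcons s' z); split=> //.
  by rewrite -rcons_cat perm_rcons perm_cons.
exact: walk_rcons ws' rz.
Qed.

Lemma pcover2_new S x y z : pcover S x y -> pcover2 (z :: S) z z x y.
Proof.
move=> [s [sS ws]]; exists [:: z], s; split=> //; first by rewrite /= perm_cons.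
exact: walk1.
Qed.

Lemma pcover2_merge S x y x' y' z :
  pcover2 S x y x' y' -> r y z -> r z x' -> pcover (z :: S) x y'.
Proof.
move=> [s [s' [sS ws ws']]] ryz rzx; exists (s ++ [:: z] ++ s'); split.
  by rewrite perm_catCA /= perm_cons.
by apply: walk_link ws _ ws'; rewrite /= ryz rzx.
Qed.

Lemma pcover_close S x y M :
  pcover S x y -> path r y (rcons M x) ->
  exists2 c, cycle r c & perm_eq c (S ++ M).
Proof.
move=> [s [sS ws]] pM; exists (s ++ M); first exact: walk_cycle ws pM.
by rewrite perm_cat2r.
Qed.

Lemma pcover2_close S x y x' y' M m :
  pcover2 S x y x' y' -> path r y (rcons M x') -> path r y' (rcons m x) ->
  exists2 c, cycle r c & perm_eq c (S ++ M ++ m).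
Proof.
move=> [s [s' [sS ws ws']]] pM pm.
exists ((s ++ M ++ s') ++ m); first exact: walk_cycle (walk_link ws pM ws') pm.
rewrite !catA perm_cat2r -catA (perm_trans (y := s ++ (s' ++ M))) //.
  by rewrite perm_cat2l perm_catC.
by rewrite catA perm_cat2r.
Qed.

(* Three strands leave the left hub [S] at [li], [lj], [lk] and enter the right
   hub [S'] at [ri], [rj], [rk]. *)
Lemma pcover2_join S S' x y li lj lk ri rj rk mi mj mk :
    pcover2 S x li lj lk -> pcover2 S' y rj ri rk ->
    path r li (rcons mi ri) -> path r lj (rcons mj rj) -> path r lk (rcons mk rk) ->
    r x y ->
  exists2 c, cycle r c & perm_eq c (S ++ S' ++ mi ++ mj ++ mk).
Proof.
move=> cS [s [s' [sS' ws ws']]] pi pj pk rxy.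
have [|||c cc pc] := @pcover2_close S x li lk lj (mi ++ s' ++ rev mk) (mj ++ rev s).
- by apply: pcover2_flip; apply: pcover2_sym; apply: pcover2_flip.
- case: ws' => l [-> pl ll]; rewrite path_split pi rcons_cat cat_path pl ll /=.
  by rewrite -path_rev.
- case/walk_rev: ws => l [-> pl ll]; rewrite path_split pj /= rcons_path pl ll.
  by rewrite r_sym.
exists c => //; apply: (perm_trans pc); rewrite perm_cat2l.
apply/permP => a; have /= := permP sS' a; rewrite !count_cat !count_rev; lia.
Qed.
End Walks.

Inductive strand := StrandA | StrandB | StrandR.

Section Hub.
Variables (T : eqType) (r : rel T).
Hypothesis r_sym : symmetric r.

(* The strands [A], [B], [R] leave the hub [S] at [p], [q], [u].  If [x] has type
   [i], then [S] is covered by a path from [x] to the exit of strand [i] and a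
   path joining the other two exits. *)
Definition typ S u p q i x :=
  match i with
  | StrandA => pcover2 r S x p u q
  | StrandB => pcover2 r S x q u p
  | StrandR => pcover2 r S x u p q
  end.

Definition hub S u p q :=
  [/\ pcover r S u p, pcover r S u q,
      forall x, x \in S -> x != p -> typ S u p q StrandB x \/ typ S u p q StrandR x
    & forall x, x \in S -> x != q -> typ S u p q StrandA x \/ typ S u p q StrandR x].

Lemma pcover2_swap S x y x' y' : pcover2 r S x y x' y' -> pcover2 r S x y y' x'.
Proof.
by move/pcover2_flip/(pcover2_sym r_sym)/pcover2_flip.
Qed.

Lemma typ_perm S S' u p q i x : perm_eq S S' -> typ S u p q i x -> typ S' u p q i x.
Proof. by case: i => /= SS'; apply: pcover2_perm. Qed.

Lemma hub_perm S S' u p q : perm_eq S S' -> hub S u p q -> hub S' u p q.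
Proof.
move=> SS' [h1 h2 h3 h4]; split; try exact: pcover_perm SS' _.
- move=> x; rewrite -(perm_mem SS') => xS xp.
  by case: (h3 x xS xp) => h; [left | right]; apply: typ_perm SS' h.
- move=> x; rewrite -(perm_mem SS') => xS xp.
  by case: (h4 x xS xp) => h; [left | right]; apply: typ_perm SS' h.
Qed.

Lemma hub_sym S u p q : hub S u p q -> hub S u q p.
Proof.
move=> [h1 h2 h3 h4]; split => // x xS xn /=.
  by case: (h4 x xS xn) => h; [left | right; apply: pcover2_swap].
by case: (h3 x xS xn) => h; [left | right; apply: pcover2_swap].
Qed.

Lemma hub_base u a b : r u a -> r u b -> r a b -> hub [:: u; a; b] u a b.
Proof.
move=> ua ub ab.
have ba : r b a by rewrite r_sym.
have bu : r b u by rewrite r_sym.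
have au : r a u by rewrite r_sym.
have wab : walk r a [:: a; b] b by exists [:: b]; rewrite /= ab.
have wua : walk r u [:: u; a] a by exists [:: a]; rewrite /= ua.
have wub : walk r u [:: u; b] b by exists [:: b]; rewrite /= ub.
have tA : pcover2 r [:: u; a; b] a a u b.
  by exists [:: a], [:: u; b]; split=> //; [apply/permP => k /=; lia | exact: walk1].
have tB : pcover2 r [:: u; a; b] b b u a.
  by exists [:: b], [:: u; a]; split=> //; [apply/permP => k /=; lia | exact: walk1].
have tR : pcover2 r [:: u; a; b] u u a b.
  by exists [:: u], [:: a; b]; split=> //; exact: walk1.
split.
- exists [:: u; b; a]; split; first by apply/permP => k /=; lia.
  by exists [:: b; a]; rewrite /= ub ba.
- by exists [:: u; a; b]; split=> //; exists [:: a; b]; rewrite /= ua ab.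
- move=> x; rewrite !inE => /or3P[] /eqP -> //=; first by right.
    by rewrite eqxx.
  by left.
- move=> x; rewrite !inE => /or3P[] /eqP -> //=; first by right.
    by left.
  by rewrite eqxx.
Qed.

Lemma hub_grow S u p q p' x :
    hub S u p q -> x \in S -> x != p -> r p p' -> r p' x ->
  hub (p' :: S) u p' q.
Proof.
move=> [h1 h2 h3 h4] xS xp pp' p'x.
have xp' : r x p' by rewrite r_sym.
have p'p : r p' p by rewrite r_sym.
split.
- exact: pcover_add h1 pp'.
- case: (h3 x xS xp) => /= h.
    by apply: (pcover2_merge (y := p) (x' := x)) => //; apply: pcover2_flip.
  apply: (pcover2_merge (y := x) (x' := p)) => //.
  by apply: pcover2_sym.
- move=> y; rewrite inE => /orP[/eqP -> | yS] yp'; first by rewrite eqxx in yp'.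
  case: (eqVneq y p) => [-> | yp].
    case: (h3 x xS xp) => /= h.
      right; apply: pcover2_swap; apply: (pcover2_add (y' := x)) => //.
      by apply: pcover2_swap; apply: pcover2_sym => //; apply: pcover2_flip.
    left; apply: (pcover2_add (y' := x)) => //.
    by apply: pcover2_swap; apply: pcover2_flip.
  case: (h3 y yS yp) => /= h; first by left; apply: pcover2_add h pp'.
  by right; apply: pcover2_swap; apply: (pcover2_add (y' := p)) => //; apply: pcover2_swap.
- move=> y; rewrite inE => /orP[/eqP -> | yS] yq.
    by left; apply: pcover2_new.
  case: (h4 y yS yq) => /= h.
    by left; apply: pcover2_flip; apply: (pcover2_add (y' := p)) => //; apply: pcover2_flip.
  by right; apply: pcover2_swap; apply: (pcover2_add (y' := p)) => //; apply: pcover2_swap.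
Qed.

(* [defect] is meant to hold for the nonadjacent pairs with large degree sum. *)
Definition hub_defect (defect : rel T) S u p q :=
  exists x y i j, [/\ i <> j, typ S u p q i x, typ S u p q j y, defect x y
                    & (x \in S) && (y \in S)].

Lemma hub_defect_sym (defect : rel T) S u p q :
  hub_defect defect S u p q -> hub_defect defect S u q p.
Proof.
pose sw i := match i with StrandA => StrandB | StrandB => StrandA | StrandR => StrandR end.
have swt i x : typ S u p q i x -> typ S u q p (sw i) x.
  by case: i => //= h; apply: pcover2_swap.
move=> [x [y [i [j [ij tx ty d m]]]]]; exists x, y, (sw i), (sw j); split=> //.
- by move: ij; case: (i); case: (j).
- exact: swt.
- exact: swt.
Qed.

Lemma hub_defect_perm (defect : rel T) S S' u p q :
  perm_eq S S' -> hub_defect defect S u p q -> hub_defect defect S' u p q.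
Proof.
move=> SS' [x [y [i [j [ij tx ty d m]]]]]; exists x, y, i, j; split=> //.
- exact: typ_perm SS' tx.
- exact: typ_perm SS' ty.
- by rewrite -!(perm_mem SS').
Qed.

Lemma hub_grow_defect (defect : rel T) S u p q p' x :
    hub S u p q -> x \in S -> x != p -> r p p' -> defect p' x ->
  hub_defect defect (p' :: S) u p' q.
Proof.
move=> [h1 h2 h3 h4] xS xp pp' d.
have tp' : typ (p' :: S) u p' q StrandA p' by apply: pcover2_new.
have m : (p' \in p' :: S) && (x \in p' :: S) by rewrite !inE eqxx xS orbT.
case: (h3 x xS xp) => h.
  by exists p', x, StrandA, StrandB; split=> //; apply: pcover2_add h pp'.
exists p', x, StrandA, StrandR; split=> //=.
by apply: pcover2_swap; apply: (pcover2_add (y' := p)) => //; apply: pcover2_swap.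
Qed.

Lemma typ_join S S' u p q v p' q' i j x y mA mB mR :
    i <> j -> typ S u p q i x -> typ S' v p' q' j y ->
    path r p (rcons mA p') -> path r q (rcons mB q') -> path r u (rcons mR v) ->
    r x y ->
  exists2 c, cycle r c & size c = size S + size S' + size mA + size mB + size mR
             /\ perm_eq c (S ++ S' ++ mA ++ mB ++ mR).
Proof.
move=> ij tx ty pA pB pR xy.
suff [c cc pc] : exists2 c, cycle r c & perm_eq c (S ++ S' ++ mA ++ mB ++ mR).
  by exists c => //; split=> //; rewrite (perm_size pc) !size_cat; lia.
have PM m1 m2 m3 c : perm_eq c (S ++ S' ++ m1 ++ m2 ++ m3) ->
    perm_eq (m1 ++ m2 ++ m3) (mA ++ mB ++ mR) -> perm_eq c (S ++ S' ++ mA ++ mB ++ mR).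
  by move=> h h'; apply: (perm_trans h); rewrite !perm_cat2l.
have sw := @pcover2_swap.
case: i j ij tx ty => [] [] //= _ tx ty.
- have [c cc pc] := pcover2_join r_sym (sw _ _ _ _ _ tx) (sw _ _ _ _ _ ty) pA pB pR xy.
  by exists c => //; apply: (PM _ _ _ _ pc); rewrite perm_refl.
- have [c cc pc] := pcover2_join r_sym tx ty pA pR pB xy.
  by exists c => //; apply: (PM _ _ _ _ pc); rewrite perm_cat2l perm_catC.
- have [c cc pc] := pcover2_join r_sym (sw _ _ _ _ _ tx) (sw _ _ _ _ _ ty) pB pA pR xy.
  by exists c => //; apply: (PM _ _ _ _ pc); rewrite !catA perm_cat2r perm_catC.
- have [c cc pc] := pcover2_join r_sym tx (sw _ _ _ _ _ ty) pB pR pA xy.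
  exists c => //; apply: (PM _ _ _ _ pc).
  by rewrite catA perm_catC.
- have [c cc pc] := pcover2_join r_sym tx ty pR pA pB xy.
  exists c => //; apply: (PM _ _ _ _ pc).
  by rewrite perm_catC -catA.
- have [c cc pc] := pcover2_join r_sym (sw _ _ _ _ _ tx) ty pR pB pA xy.
  exists c => //; apply: (PM _ _ _ _ pc).
  by apply/permP => k; rewrite !count_cat; lia.
Qed.
End Hub.

Lemma induced_edge_list (G : sgraph) n es (t : seq G) (x0 : G) :
    uniq t -> size t = n ->
    (forall i j : 'I_n, adj (nth x0 t i) (nth x0 t j) = edge_list_adj es i j) ->
  isomorphic (induced [set x in t]) (edge_list_graph n es).
Proof.
move=> ut st adjt.
have fP (x : {x : G | x \in [set x in t]}) : index (val x) t < n.
  by rewrite -st index_mem; have := valP x; rewrite inE.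
have gP (i : 'I_n) : nth x0 t i \in [set x in t] by rewrite inE mem_nth // st.
exists (fun x => Ordinal (fP x)).
  exists (fun i : 'I_n => exist _ (nth x0 t i) (gP i)).
    move=> x; apply/val_inj; rewrite /= nth_index //.
    by have := valP x; rewrite inE.
  by move=> i; apply/val_inj; rewrite /= index_uniq // st.
move=> x y; rewrite /= -adjt /= !nth_index //.
  by have := valP y; rewrite inE.
by have := valP x; rewrite inE.
Qed.

Section OAdj.
Variable G : sgraph.
Implicit Types x y z : G.

Definition defect x y :=
  [&& x != y, ~~ adj x y & #|G| <= degree x + degree y].

Definition oadj x y := adj x y || defect x y.

Lemma defect_sym : symmetric defect.
Proof. by move=> x y; rewrite /defect eq_sym adj_sym addnC. Qed.

Lemma oadj_sym : symmetric oadj.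
Proof. by move=> x y; rewrite /oadj adj_sym defect_sym. Qed.

Lemma oadj_irrefl : irreflexive oadj.
Proof. by move=> x; rewrite /oadj adj_irrefl /defect eqxx. Qed.

Lemma adj_oadj x y : adj x y -> oadj x y.
Proof. by rewrite /oadj => ->. Qed.

Lemma adj_neq x y : adj x y -> x != y.
Proof. by apply: contraTneq => ->; rewrite adj_irrefl. Qed.

Lemma noadj_sum x y : x != y -> ~~ oadj x y -> degree x + degree y < #|G|.
Proof.
by move=> xy; rewrite /oadj /defect xy negb_or => /andP[-> /=]; rewrite -ltnNge.
Qed.

(* Both degree sums of the two defects would have to reappear in the crossed pairs. *)
Lemma defects_cross x y x' y' :
    defect x y -> defect x' y' -> x != x' -> y != y' ->
  oadj x x' \/ oadj y y'.
Proof.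
move=> /and3P[_ _ dxy] /and3P[_ _ dxy'] xx yy.
case: (boolP (oadj x x')) => [|/(noadj_sum xx)]; first by left.
case: (boolP (oadj y y')) => [|/(noadj_sum yy)]; first by right.
lia.
Qed.

Hypothesis claw_heavy : graph_heavy claw G.
Hypothesis wounded_heavy : graph_heavy wounded G.

Lemma heavy_oadj (t : seq G) : heavy [set x in t] ->
  exists x y, [/\ x \in t, y \in t, ~~ adj x y & oadj x y].
Proof.
move=> [x [y []]]; rewrite !inE => xt yt xy nxy dxy.
by exists x, y; split=> //; rewrite /oadj /defect xy nxy dxy orbT.
Qed.

Lemma claw_oadj c x y z :
    adj c x -> adj c y -> adj c z -> x != y -> x != z -> y != z ->
    ~~ oadj x y -> ~~ oadj x z -> oadj y z.
Proof.
move=> cx cy cz xy xz yz nxy nxz; apply: contraT => nyz.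
have na a b : ~~ oadj a b -> (adj a b = false) * (adj b a = false).
  by rewrite /oadj negb_or (adj_sym b) => /andP[/negbTE ->].
have ut : uniq [:: c; x; y; z].
  by rewrite /= !inE !negb_or xy xz yz !adj_neq.
have iso : isomorphic (induced [set w in [:: c; x; y; z]]) claw.
  apply: (@induced_edge_list G 4 _ [:: c; x; y; z] c) => //.
  move=> [[|[|[|[|i]]]] //= hi] [[|[|[|[|j]]]] //= hj];
    rewrite /edge_list_adj -val_eqE /= ?adj_irrefl ?cx ?cy ?cz ?(na _ _ nxy)
      ?(na _ _ nxz) ?(na _ _ nyz) // adj_sym //.
have [a [b []]] := heavy_oadj (claw_heavy iso).
rewrite !inE => /or4P[] /eqP -> /or4P[] /eqP ->;
  rewrite ?adj_irrefl ?oadj_irrefl ?cx ?cy ?cz ?(negbTE nxy) ?(negbTE nxz)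
    ?(negbTE nyz) //; rewrite 1?adj_sym ?cx ?cy ?cz // oadj_sym
    ?(negbTE nxy) ?(negbTE nxz) ?(negbTE nyz) //.
Qed.

Lemma wounded_oadj a b c a' b' b'' :
    adj a b -> adj a c -> adj b c -> adj a a' -> adj b b' -> adj b' b'' ->
    ~~ oadj a b' -> ~~ oadj a b'' -> ~~ oadj b a' -> ~~ oadj b b'' ->
    ~~ oadj c a' -> ~~ oadj c b' -> ~~ oadj c b'' -> ~~ oadj a' b' ->
    ~~ oadj a' b'' -> False.
Proof.
move=> ab ac bc aa bb bb' n1 n2 n3 n4 n5 n6 n7 n8 n9.
have na x y : ~~ oadj x y -> (adj x y = false) * (adj y x = false).
  by rewrite /oadj negb_or (adj_sym y) => /andP[/negbTE ->].
have sy x y : adj x y -> adj y x by rewrite adj_sym.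
have ne x y z : adj x z -> adj y z = false -> x != y.
  by move=> xz yz; apply: contraTneq xz => ->; rewrite yz.
have ut : uniq [:: a; b; c; a'; b'; b''].
  rewrite /= !inE !negb_or !(adj_neq ab, adj_neq ac, adj_neq bc, adj_neq aa,
    adj_neq bb, adj_neq bb') /= !andbT.
  do !(apply/andP; split).
  - by apply: (ne _ _ _ ac); rewrite adj_sym (na _ _ n6).
  - by apply: (ne _ _ _ ac); rewrite adj_sym (na _ _ n7).
  - by apply: (ne _ _ _ bc); rewrite adj_sym (na _ _ n5).
  - by apply: (ne _ _ _ bc); rewrite adj_sym (na _ _ n7).
  - by apply: (ne _ _ _ (sy _ _ bc)); rewrite adj_sym (na _ _ n3).
  - by apply: (ne _ _ _ (sy _ _ ac)); rewrite adj_sym (na _ _ n1).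
  - by apply: (ne _ _ _ (sy _ _ ac)); rewrite adj_sym (na _ _ n2).
  - by apply: (ne _ _ _ (sy _ _ aa)); rewrite adj_sym (na _ _ n1).
  - by apply: (ne _ _ _ (sy _ _ aa)); rewrite adj_sym (na _ _ n2).
have iso : isomorphic (induced [set x in [:: a; b; c; a'; b'; b'']]) wounded.
  apply: (@induced_edge_list G 6 _ [:: a; b; c; a'; b'; b''] a) => //.
  move=> [[|[|[|[|[|[|i]]]]]] //= hi] [[|[|[|[|[|[|j]]]]]] //= hj];
    rewrite /edge_list_adj -val_eqE /= ?adj_irrefl ?ab ?ac ?bc ?aa ?bb ?bb'
      ?(na _ _ n1) ?(na _ _ n2) ?(na _ _ n3) ?(na _ _ n4) ?(na _ _ n5)
      ?(na _ _ n6) ?(na _ _ n7) ?(na _ _ n8) ?(na _ _ n9) // adj_sym //.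
have [x [y []]] := heavy_oadj (wounded_heavy iso).
rewrite !inE => /or4P[/eqP->|/eqP->|/eqP->|/or3P[]/eqP->]
  /or4P[/eqP->|/eqP->|/eqP->|/or3P[]/eqP->];
  rewrite ?adj_irrefl ?oadj_irrefl ?ab ?ac ?bc ?aa ?bb ?bb'
    ?(negbTE n1) ?(negbTE n2) ?(negbTE n3) ?(negbTE n4) ?(negbTE n5)
    ?(negbTE n6) ?(negbTE n7) ?(negbTE n8) ?(negbTE n9) //;
  rewrite adj_sym oadj_sym ?ab ?ac ?bc ?aa ?bb ?bb'
    ?(negbTE n1) ?(negbTE n2) ?(negbTE n3) ?(negbTE n4) ?(negbTE n5)
    ?(negbTE n6) ?(negbTE n7) ?(negbTE n8) ?(negbTE n9) //.
Qed.
End OAdj.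

Lemma count_consecutive (T : eqType) (P Q : pred T) x (t : seq T) :
    (forall t1 a b t2, x :: t = rcons t1 a ++ b :: t2 -> ~~ (P a && Q b)) ->
  count P (belast x t) + count Q t <= size t.
Proof.
elim: t x => //= b t IHt x H.
have := H [::] x b t erefl; have : count P (belast b t) + count Q t <= size t.
  apply: IHt => t1 a c t2 e; apply: (H (x :: t1) a c t2).
  by rewrite /= e.
by case: (P x) (Q b) => [] [] //= *; lia.
Qed.

Lemma cycle_bad_edge (T : eqType) (e : rel T) (c : seq T) :
    uniq c -> ~~ cycle e c ->
  exists x t, perm_eq (x :: t) c /\ (~~ e (last x t) x /\
    forall e' : rel T, cycle e' c -> cycle e' (x :: t)).
Proof.
move=> uc nc.
have [/allP H | /allPn[y yc ny]] := boolP (all (fun y => e y (next c y)) c).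
  by case/negP: nc; apply: cycle_from_next.
have /rot_to[i t rc] : next c y \in c by rewrite mem_next.
exists (next c y), t; split; first by rewrite -rc perm_rot.
split; last by move=> e'; rewrite -rc rot_cycle.
have yE : y = prev (next c y :: t) (next c y) by rewrite -rc prev_rot // prev_next.
rewrite [y in e y _]yE in ny.
have : next c y \notin t by have := rot_uniq i c; rewrite rc uc => /andP[].
move: ny; rewrite /prev; move: (next c y) => x.
move=> ny xt; suff <- : prev_at x x x t = last x t by [].
have: forall z, x \notin t -> prev_at x x z t = last z t.
  elim: (t) => [|a t' IHt] z /=; first by rewrite eqxx.
  by rewrite inE negb_or => /andP[/negbTE -> xt']; apply: IHt.
by apply.
Qed.

Section OCycle.
Variable G : sgraph.
Implicit Types x y z : G.

Lemma degree_split (s : seq G) x : uniq s ->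
  degree x = count (adj x) s + #|[set y | adj x y] :\: [set y in s]|.
Proof.
move=> us; rewrite /degree -(cardsID [set y in s]); congr (_ + _).
rewrite -size_filter -(card_uniqP (filter_uniq _ us)).
by apply: eq_card => y; rewrite !inE mem_filter.
Qed.

(* Ore's exchange: a nonadjacent closing pair of large degree sum is bypassed
   through a common neighbour outside the cycle or by crossing two chords. *)
Lemma ore_exchange (e : rel G) x (t : seq G) :
    symmetric e -> (forall a b, adj a b -> e a b) ->
    uniq (x :: t) -> path e x t -> defect x (last x t) ->
  exists c, [/\ uniq c, cycle e c & size (x :: t) <= size c].
Proof.
move=> e_sym adj_e us pt /and3P[_ nxy dxy].
set y := last x t in nxy dxy.
have [/existsP[w /and3P[ws xw yw]] | nw] :=
    boolP [exists w, [&& w \notin x :: t, adj x w & adj y w]].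
  exists (w :: x :: t); split=> //=; first by rewrite ws.
  by rewrite rcons_path pt -/y !adj_e // adj_sym.
have : #|[set z | adj x z] :\: [set z in x :: t]| +
       #|[set z | adj y z] :\: [set z in x :: t]| + size (x :: t) <= #|G|.
  rewrite -(card_uniqP us) -(cardsE (mem (x :: t))).
  set X := _ :\: _; set Y := _ :\: _; set S := [set z in _].
  have XY : [disjoint X & Y].
    rewrite -setI_eq0; apply/eqP/setP => z; rewrite !inE -!andbA.
    apply/negbTE; apply/negP => /and4P[zs xz _ yz]; case/negP: nw; apply/existsP.
    by exists z; rewrite inE zs xz.
  have XYS : [disjoint X :|: Y & S].
    by rewrite -setI_eq0; apply/eqP/setP => z; rewrite !inE; case: (z == x); case: (z \in t); rewrite ?andbF.
  have -> : #|X| + #|Y| + #|S| = #|X :|: Y :|: S|.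
    by rewrite !cardsU (disjoint_setI0 XY) (disjoint_setI0 XYS) cards0 !subn0.
  exact: max_card.
rewrite (degree_split x us) (degree_split y us) in dxy.
move=> H.
have cy : count (adj y) (x :: t) = count (adj y) (belast x t).
  by rewrite lastI -cats1 count_cat /= -/y adj_irrefl !addn0.
have cx : count (adj x) (x :: t) = count (adj x) t by rewrite /= adj_irrefl.
have [[[[t1 a] b] t2] /= E ab] : exists2 q, x :: t = rcons q.1.1.1 q.1.1.2 ++ q.1.2 :: q.2
    & adj y q.1.1.2 && adj x q.1.2.
  apply: NNPP => Hn.
  have := @count_consecutive _ (adj y) (adj x) x t; have -> : count (adj y) (belast x t) + count (adj x) t <= size t = false.
    by apply/negbTE; move: H dxy; rewrite [size _]/=; lia.
  case/(_ _)/notF => t1 a b t2 E; apply/negP => ab; case: Hn.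
  by exists (t1, a, b, t2).
have wxy : walk e x (x :: t) y by exists t.
move: (wxy); rewrite E => /walk_uncat[w1 _ w2].
exists (rcons t1 a ++ rev (b :: t2)); split.
- by rewrite cat_uniq rev_uniq has_rev -cat_uniq -E.
- have wc : walk e x (rcons t1 a ++ rev (b :: t2)) b.
    apply: walk_cat w1 _ (walk_rev e_sym w2).
    by apply: adj_e; rewrite adj_sym; case/andP: ab.
  have := walk_cycle (m := [::]) wc; rewrite cats0; apply.
  by rewrite /= adj_e // adj_sym; case/andP: ab.
- by rewrite size_cat size_rev -size_cat -E.
Qed.

Lemma long_adj_cycle (e : rel G) (c : seq G) :
    symmetric e -> (forall a b, adj a b -> e a b) ->
    (forall a b, e a b -> oadj a b) ->
    uniq c -> cycle e c -> 2 < size c ->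
  exists c', [/\ uniq c', cycle (@adj G) c' & size c <= size c'].
Proof.
have [n] := ubnP #|[set z : G * G | e z.1 z.2 && ~~ adj z.1 z.2]|.
elim: n e c => // n IHn e c le_n e_sym adj_e e_oadj uc cc sc.
have [ac | nac] := boolP (cycle (@adj G) c); first by exists c.
have [x [t [pc [nxt tc]]]] := cycle_bad_edge uc nac.
have ut : uniq (x :: t) by rewrite (perm_uniq pc).
have st := perm_size pc.
have := tc e cc; rewrite /= rcons_path => /andP[pt exy].
case: t => [|b [|b' t]] in pc nxt tc ut st pt exy *; try by rewrite -st in sc.
set y := last x _ in nxt exy.
pose e' u w := e u w && ~~ (((u == x) && (w == y)) || ((u == y) && (w == x))).
have [/= xt bt] : x \notin [:: b, b' & t] /\ b \notin b' :: t.
  by move: ut => /= /and3P[? ? _].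
have yt : y \in b' :: t by rewrite /y /= mem_last.
have xy : x != y by apply: contraNneq xt => ->; rewrite inE yt orbT.
have yb : b != y by apply: contraNneq bt => ->.
have dxy : defect x y.
  by move/e_oadj: exy; rewrite /oadj (negbTE nxt) defect_sym.
have pt' : path e' x [:: b, b' & t].
  move: pt => /= /andP[xb pt]; apply/andP; split.
    by rewrite /e' xb (negbTE yb) (negbTE xy) andbF.
  apply: (@sub_in_path _ (predC1 x) e e' _ b (b' :: t)) => //.
    move=> u w; rewrite !inE => ux wx uw.
    by rewrite /e' uw (negbTE ux) (negbTE wx) andbF.
  apply/allP => u ut'; rewrite !inE; apply: contraNneq xt => <-.
  by move: ut'; rewrite !inE.
have e'_sym : symmetric e'.
  move=> u w; rewrite /e' e_sym; congr (_ && ~~ _).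
  by rewrite orbC; congr (_ || _); apply: andbC.
have adj_e' u w : adj u w -> e' u w.
  move=> uw; rewrite /e' adj_e //=; apply: contra nxt.
  by case/orP=> /andP[/eqP <- /eqP <-]; rewrite // adj_sym.
have [c1 [uc1 cc1 sc1]] := ore_exchange e'_sym adj_e' ut pt' dxy.
have [|||c2 [uc2 cc2 sc2]] := IHn e' c1 _ e'_sym adj_e' _ uc1 cc1.
- rewrite ltnS in le_n; apply: leq_trans le_n; apply: proper_card; apply/properP; split.
    by apply/subsetP=> z; rewrite !inE => /andP[/andP[-> _] ->].
  exists (x, y); rewrite !inE /=; last by rewrite /e' !eqxx andbF.
  by rewrite e_sym exy adj_sym.
- by move=> u w /andP[/e_oadj].
- by rewrite -st in sc; apply: leq_trans sc1.
by exists c2; split=> //; rewrite -st; apply: leq_trans sc2.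
Qed.
End OCycle.

Section Levels.
Variables (T : finType) (e : rel T) (D : {set T}) (z : T).

Definition ball k : {set T} :=
  iter k (fun S => S :|: [set x in D | [exists y in S, e y x]]) [set z].

Definition level k : {set T} := if k is j.+1 then ball j.+1 :\: ball j else ball 0.

Lemma ball_mono j k : j <= k -> ball j \subset ball k.
Proof.
move=> /subnK <-; elim: (k - j) => //= i IHi.
by apply: subset_trans IHi (subsetUl _ _).
Qed.

Lemma ballS k x y : x \in ball k -> y \in D -> e x y -> y \in ball k.+1.
Proof.
move=> xk yD xy; rewrite /= !inE yD /=; apply/orP; right.
by apply/exists_inP; exists x.
Qed.

Lemma path_ball k x s : x \in ball k -> path e x s -> {subset s <= D} ->
  last x s \in ball (k + size s).
Proof.
elim: s k x => [|y s IHs] k x xk /=; first by rewrite addn0.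
case/andP=> xy ps sD; rewrite addnS -addSn; apply: IHs => //.
  by apply: ballS xk _ xy; apply: sD; rewrite inE eqxx.
by move=> w ws; apply: sD; rewrite inE ws orbT.
Qed.

Lemma sub_level_ball k : level k \subset ball k.
Proof. by case: k => // k; apply: subsetDl. Qed.

Lemma level_pred k x : x \in level k.+1 ->
  x \in D /\ exists2 y, y \in level k & e y x.
Proof.
rewrite /level in_setD => /andP[nx]; rewrite /= in_setU (negbTE nx) inE /=.
case/andP=> xD /exists_inP[y yk yx]; split=> //; exists y => //.
case: k => [|k] in yk nx *; first by [].
rewrite /level in_setD yk andbT; apply: contra nx => yk'.
exact: ballS yk' xD yx.
Qed.

Lemma level_inj j k x : x \in level j -> x \in level k -> j = k.
Proof.
wlog jk : j k / j <= k => [H xj xk|].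
  by case/orP: (leq_total j k) => ?; [apply: H | symmetry; apply: H].
move=> xj; case: k => [|k] in jk *; first by move: jk; rewrite leqn0 => /eqP.
rewrite inE => /andP[xk _]; apply/eqP; rewrite eqn_leq jk ltnNge.
apply: contra xk => jk'; apply: (subsetP (ball_mono jk')).
by apply: (subsetP (sub_level_ball j)).
Qed.

Lemma ball_level k x : x \in ball k -> exists2 j, j <= k & x \in level j.
Proof.
elim: k => [|k IHk]; first by exists 0.
have [xk _ | xk xk1] := boolP (x \in ball k).
  by have [j jk xj] := IHk xk; exists j => //; apply: leqW.
by exists k.+1 => //; rewrite /level inE xk.
Qed.

Lemma level_far j k x y : x \in level j -> y \in level k -> j.+1 < k -> ~~ e x y.
Proof.
case: k => // k xj yk jk; have [yD _] := level_pred yk.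
move: yk; rewrite inE => /andP[yk _]; apply: contra yk => xy.
apply: (subsetP (ball_mono (_ : j.+1 <= k))) => //.
by apply: ballS xy => //; apply: (subsetP (sub_level_ball j)).
Qed.

Lemma path_level k m j x s : x \in level k -> path e x s -> {subset s <= D} ->
    last x s \in level m -> k <= j <= m ->
  exists2 y, y \in x :: s & y \in level j.
Proof.
elim: s k x => [|a s IHs] k x xk /=.
  move=> _ _ xm kjm; exists x; first by rewrite inE.
  by have E := level_inj xk xm; rewrite -(_ : k = j) //; lia.
case/andP=> xa ps sD am /andP[kj jm].
have [-> | kj'] := eqVneq j k; first by exists x; rewrite // inE eqxx.
have aD : a \in D by apply: sD; rewrite inE eqxx.
have ak : a \in ball k.+1.
  by apply: ballS aD xa; apply: (subsetP (sub_level_ball k)).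
have [i ik ai] := ball_level ak.
have [||y ys yj] := IHs i a ai ps _ am.
- by move=> w ws; apply: sD; rewrite inE ws orbT.
- by lia.
by exists y => //; rewrite inE ys orbT.
Qed.
End Levels.

Section BlockedHub.
Variable G : sgraph.
Hypothesis claw_heavy : graph_heavy claw G.
Hypothesis wounded_heavy : graph_heavy wounded G.

Section Layers.
Variables (D : {set G}) (z : G).
Hypothesis zD : z \in D.
Hypothesis cleanD : {in D &, forall x y, oadj x y -> adj x y}.
Notation lev := (level (@adj G) D z).

Lemma level_sub k x : x \in lev k -> x \in D.
Proof. by case: k => [|k]; [rewrite inE => /eqP-> | case/level_pred]. Qed.

Lemma level_noadj j k x y : x \in lev j -> y \in lev k -> j.+1 < k ->
  ~~ oadj x y /\ ~~ oadj y x.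
Proof.
move=> xj yk jk; have nxy : ~~ oadj x y.
  by apply: contra (level_far xj yk jk); apply: cleanD; apply: level_sub; eassumption.
by rewrite [oadj y x]oadj_sym.
Qed.

Let d2 i : i.+1 < i.+2. Proof. exact: ltnSn. Qed.
Let d3 i : i.+1 < i.+3. Proof. exact: ltnW. Qed.
Let d4 i : i.+1 < i.+4. Proof. by rewrite ltnS ltnW // ltnW. Qed.

Hypothesis level1 : {in lev 1 &, forall x y, x = y}.
Hypothesis level2 : {in lev 2 &, forall x y, x = y}.

Lemma levels_complete k :
  {in lev k.+2 &, forall x y, x != y -> adj x y} /\
  {in lev k.+1 & lev k.+2, forall x y, adj x y}.
Proof.
elim: k => [|k [clq cmp]].
  split=> x y x1 y2; first by rewrite (level2 x1 y2) eqxx.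
  by have [_ [y' y1 ad]] := level_pred y2; rewrite (level1 x1 y1).
have cmp' : {in lev k.+2 & lev k.+3, forall x y, adj x y}.
  move=> y' w y'k wk; have [_ [y yk yw]] := level_pred wk.
  have [-> // | yy] := eqVneq y' y; apply: contraT => nyw.
  case: k => [|k] in clq cmp y'k wk yk *; first by case/eqP: yy; apply: level2.
  have [_ [x xk xy]] := level_pred yk.
  have [_ [x2 x2k x2x]] := level_pred xk.
  have [_ [x3 x3k x3x]] := level_pred x2k.
  have nyw' : ~~ oadj y' w.
    by apply: contra nyw; apply: cleanD; apply: level_sub; eassumption.
  case: (@wounded_oadj G wounded_heavy y x y' w x2 x3) => //.
  - by rewrite adj_sym.
  - by apply: clq => //; rewrite eq_sym.
  - exact: cmp.
  - by rewrite adj_sym.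
  - by rewrite adj_sym.
  - exact: (level_noadj x2k yk (d2 _)).2.
  - exact: (level_noadj x3k yk (d3 _)).2.
  - exact: (level_noadj xk wk (d2 _)).1.
  - exact: (level_noadj x3k xk (d2 _)).2.
  - exact: (level_noadj x2k y'k (d2 _)).2.
  - exact: (level_noadj x3k y'k (d3 _)).2.
  - exact: (level_noadj x2k wk (d3 _)).2.
  - exact: (level_noadj x3k wk (d4 _)).2.
split=> // w w' wk w'k ww'.
have [_ [y yk yw]] := level_pred wk.
have [_ [x xk xy]] := level_pred yk.
have neqlev a b i j : a \in lev i -> b \in lev j -> i != j -> a != b.
  by move=> ai bj; apply: contra_neq => ab; apply: level_inj ai _; rewrite ab.
apply: cleanD; try by apply: level_sub; eassumption.
apply: (@claw_oadj G claw_heavy y x) => //.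
- by rewrite adj_sym.
- exact: cmp'.
- by apply: (neqlev _ _ _ _ xk wk); rewrite neq_ltn leqnSn.
- by apply: (neqlev _ _ _ _ xk w'k); rewrite neq_ltn leqnSn.
- exact: (level_noadj xk wk (d2 _)).1.
- exact: (level_noadj xk w'k (d2 _)).1.
Qed.

Lemma level_pendant k p p' y : p \in lev k.+3 -> y \in lev k.+3 -> p != y ->
  adj p p' -> {in D, forall x, x != p -> ~~ oadj p' x} -> False.
Proof.
move=> pk yk py pp' np'.
have [clq cmp] := levels_complete k.+1.
have [_ [x xk xp]] := level_pred pk.
have [_ [x2 x2k x2x]] := level_pred xk.
have [_ [x3 x3k x3x]] := level_pred x2k.
have neqlev a b i j : a \in lev i -> b \in lev j -> i != j -> a != b.
  by move=> ai bj; apply: contra_neq => ab; apply: level_inj ai _; rewrite ab.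
have np a i : a \in lev i -> a != p -> ~~ oadj p' a.
  by move=> ai; apply: np'; apply: level_sub ai.
apply: (@wounded_oadj G wounded_heavy p x y p' x2 x3) => //.
- by rewrite adj_sym.
- exact: clq.
- exact: cmp.
- by rewrite adj_sym.
- by rewrite adj_sym.
- exact: (level_noadj x2k pk (d2 _)).2.
- exact: (level_noadj x3k pk (d3 _)).2.
- rewrite oadj_sym; apply: (np _ _ xk); apply: (neqlev _ _ _ _ xk pk).
  by rewrite neq_ltn leqnn.
- exact: (level_noadj x3k xk (d2 _)).2.
- by rewrite oadj_sym; apply: (np _ _ yk); rewrite eq_sym.
- exact: (level_noadj x2k yk (d2 _)).2.
- exact: (level_noadj x3k yk (d3 _)).2.
- by apply: (np _ _ x2k); apply: (neqlev _ _ _ _ x2k pk); rewrite neq_ltn leqnSn.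
- by apply: (np _ _ x3k); apply: (neqlev _ _ _ _ x3k pk); rewrite neq_ltn; apply/orP; left; lia.
Qed.
End Layers.

(* The hub [u :: A1 ++ B1] cannot be blocked on both strands [A] and [B]: the
   breadth-first levels rooted at [z2] are cliques joined completely to the next
   level, so the exit of lower level has a twin on the other strand. *)
Lemma blocked_hub_absurd (z2 z1 u : G) (A1 B1 : seq G) p' q' :
    let D := [set x in [:: z2, z1, u & A1 ++ B1]] in
    uniq [:: z2, z1, u & A1 ++ B1] -> A1 != [::] -> B1 != [::] ->
    adj u z1 -> adj z1 z2 -> path (@adj G) u A1 -> path (@adj G) u B1 ->
    ~~ oadj u z2 ->
    {in A1 ++ B1, forall x, ~~ oadj x z1 /\ ~~ oadj x z2} ->
    {in u :: A1 ++ B1 &, forall x y, oadj x y -> adj x y} ->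
    adj (last u A1) p' -> adj (last u B1) q' ->
    {in D, forall x, x != last u A1 -> ~~ oadj p' x} ->
    {in D, forall x, x != last u B1 -> ~~ oadj q' x} ->
  False.
Proof.
move=> D ut A1n B1n uz1 z12 pA pB uz2 nz clean pp' qq' np' nq'.
have zD : z2 \in D by rewrite !inE eqxx.
have z1u := negbTE (adj_neq uz1); have z1z2 := negbTE (adj_neq z12).
have [z2s z1s us] : [/\ z2 \notin [:: z1, u & A1 ++ B1], z1 \notin u :: A1 ++ B1
    & u \notin A1 ++ B1].
  by case/and4P: ut.
have Dcase x : x \in D -> [\/ x = z2, x = z1, x = u | x \in A1 ++ B1].
  rewrite inE in_cons => /predU1P[|]; first by constructor 1.
  rewrite in_cons => /predU1P[|]; first by constructor 2.
  by rewrite in_cons => /predU1P[|]; [constructor 3 | constructor 4].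
have cleanD : {in D &, forall x y, oadj x y -> adj x y}.
  have c1 w : w \in u :: A1 ++ B1 -> oadj w z1 -> adj w z1.
    by rewrite inE => /predU1P[-> // | /nz[/negbTE->]].
  have c2 w : w \in u :: A1 ++ B1 -> oadj w z2 -> adj w z2.
    by rewrite inE => /predU1P[-> | /nz[_ /negbTE->] //]; rewrite (negbTE uz2).
  have inS w : [\/ w = z2, w = z1, w = u | w \in A1 ++ B1] ->
      [\/ w = z2, w = z1 | w \in u :: A1 ++ B1].
    move=> [->|->|->|H]; [constructor 1|constructor 2|constructor 3|constructor 3] => //.
      by rewrite inE eqxx.
    by rewrite inE H orbT.
  move=> x y /Dcase/inS xD /Dcase/inS yD.
  case: xD => [->|->|xs]; case: yD => [->|->|ys]; rewrite ?oadj_irrefl //.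
  - by rewrite (adj_sym z2) z12.
  - by rewrite oadj_sym adj_sym; apply: c2.
  - by rewrite oadj_sym adj_sym; apply: c1.
  - exact: c2.
  - exact: c1.
  - exact: clean.
have lev0 x : x \in level (@adj G) D z2 0 -> x = z2.
  by rewrite inE => /eqP.
have lev1 x : x \in level (@adj G) D z2 1 -> x = z1.
  case/level_pred => xD [y]; rewrite inE => /eqP -> z2x.
  case: (Dcase x xD) => [xE|//|xE|xs].
  - by rewrite xE adj_irrefl in z2x.
  - by case/negP: uz2; rewrite -xE adj_oadj // adj_sym.
  - by have [_ /negP[]] := nz x xs; rewrite adj_oadj // adj_sym.
have lev2 x : x \in level (@adj G) D z2 2 -> x = u.
  move=> xl; have [xD [y /lev1 -> z1x]] := level_pred xl.
  case: (Dcase x xD) => [xE|xE|//|xs].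
  - suff : 0 = 2 by [].
    by apply: (level_inj _ xl); rewrite xE !inE.
  - by rewrite xE adj_irrefl in z1x.
  - by have [/negP[]] := nz x xs; rewrite adj_oadj // adj_sym.
have level1 : {in level (@adj G) D z2 1 &, forall x y, x = y}.
  by move=> x y /lev1 -> /lev1 ->.
have level2 : {in level (@adj G) D z2 2 &, forall x y, x = y}.
  by move=> x y /lev2 -> /lev2 ->.
have z1D : z1 \in D by rewrite !inE eqxx !orbT.
have uD : u \in D by rewrite !inE eqxx !orbT.
have ub : u \in ball (@adj G) D z2 2.
  apply: (ballS (x := z1)) => //; last by rewrite adj_sym.
  by apply: (ballS (x := z2)) => //; rewrite ?inE // adj_sym.
have ul : u \in level (@adj G) D z2 2.
  have [j j2 uj] := ball_level ub.
  case: j => [|[|[|j]]] in j2 uj *; last by [].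
  - by move: z2s; rewrite -(lev0 _ uj) !inE eqxx orbT.
  - by rewrite (lev1 _ uj) adj_irrefl in uz1.
  - exact: uj.
have subA : {subset A1 <= D} by move=> x xA; rewrite !inE mem_cat xA !orbT.
have subB : {subset B1 <= D} by move=> x xA; rewrite !inE mem_cat xA !orbT.
have high x j : x \in A1 ++ B1 -> x \in level (@adj G) D z2 j -> 2 < j.
  move=> xs; case: j => [|[|[|j _]]]; last by [].
  - by move/lev0 => xE; move: z2s; rewrite -xE 2!inE xs !orbT.
  - by move/lev1 => xE; move: z1s; rewrite -xE inE xs !orbT.
  - by move/lev2 => xE; move: us; rewrite -xE xs.
have [j _ pj] := ball_level (path_ball ub pA subA).
have [k _ qk] := ball_level (path_ball ub pB subB).
have lastin (s : seq G) : s != [::] -> last u s \in s.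
  by case: s => // a s _; rewrite /= mem_last.
have pA1 := lastin A1 A1n; have qB1 := lastin B1 B1n.
have uAB : uniq (u :: A1 ++ B1) by case/and3P: ut.
have [jk | /ltnW kj] := leqP j k.
  have j3 : 2 < j by apply: high pj; rewrite mem_cat pA1.
  have jj : 2 <= j <= k by rewrite jk ltnW.
  have [y yB yj] := path_level ul pB subB qk jj.
  case: j => [|[|[|j]]] // in pj j3 jj jk yj *.
  apply: (level_pendant zD cleanD level1 level2 pj yj) np' => //.
  apply: contraTneq yB => <-; rewrite inE negb_or; apply/andP; split.
    by apply: contraNneq us => <-; rewrite mem_cat pA1.
  by move: uAB; rewrite /= cat_uniq => /and4P[_ _ /hasPn nB _]; apply: contraL pA1 => /nB.
have k3 : 2 < k by apply: high qk; rewrite mem_cat qB1 orbT.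
have jj : 2 <= k <= j by rewrite kj ltnW.
have [y yB yj] := path_level ul pA subA pj jj.
case: k => [|[|[|k]]] // in qk k3 jj kj yj *.
apply: (level_pendant zD cleanD level1 level2 qk yj) nq' => //.
apply: contraTneq yB => <-; rewrite inE negb_or; apply/andP; split.
  by apply: contraNneq us => <-; rewrite mem_cat qB1 orbT.
by move: uAB; rewrite /= cat_uniq => /and4P[_ _ /hasPn nB _]; apply: nB.
Qed.
End BlockedHub.

(* [lia] splits on every boolean that is coerced to [nat]: hide them first. *)
Ltac count_lia :=
  do 6 rewrite /= ?(count_cat, count_rev, size_cat, size_rev, size_rcons);
  repeat match goal with
  | |- context [nat_of_bool ?b] => generalize (nat_of_bool b)
  | |- context [@count ?T ?P ?s] => generalize (@count T P s)
  end; clear; intros; lia.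

Lemma uniq_count_le (T : eqType) (s t : seq T) :
  uniq t -> (forall x, count_mem x s <= count_mem x t) -> uniq s.
Proof.
move=> ut st; apply: count_mem_uniq => x.
have := st x; rewrite (count_uniq_mem x ut) -[x \in s]has_pred1 has_count.
by case: (x \in t); case: (count_mem x s) => [|[|n]].
Qed.

Lemma path_rev_link (T : eqType) (r : rel T) (w q : T) s :
  symmetric r -> path r q s -> r w (last q s) -> path r w (rcons (rev s) q).
Proof.
by move=> r_sym ps wq; rewrite path_rev // revK rcons_path ps r_sym.
Qed.

Section Theta.
Variable G : sgraph.

(* [u A v (rev B)] is a cycle, [Z] a path outside it joining [u] to [v]; the
   strands [A] and [B] are both read from [u] to [v]. *)
Record theta (u v : G) (Z A B : seq G) : Prop := Theta {
  theta_uniq : uniq [:: u, v & Z ++ A ++ B];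
  theta_A : path (@adj G) u (rcons A v);
  theta_B : path (@adj G) u (rcons B v);
  theta_Z : path (@adj G) u (rcons Z v);
  theta_nil : [&& Z != [::], A != [::] & B != [::]];
  theta_top : forall c : seq G, uniq c -> cycle (@oadj G) c ->
    size c <= size A + size B + 2 }.

Lemma theta_swap u v Z A B : theta u v Z A B -> theta u v Z B A.
Proof.
move=> [h1 h2 h3 h4 h5 h6]; split=> //.
- by apply: (uniq_count_le h1) => x; count_lia.
- by move: h5; rewrite andbCA andbC -andbA andbCA.
- by move=> c uc cc; rewrite [size B + _]addnC; apply: h6.
Qed.

Lemma theta_rev u v Z A B : theta u v Z A B -> theta v u (rev Z) (rev A) (rev B).
Proof.
move=> [h1 h2 h3 h4 h5 h6].
have R s : path (@adj G) u (rcons s v) -> path (@adj G) v (rcons (rev s) u).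
  by rewrite path_rev //; apply: adj_sym.
split; try exact: R.
- by apply: (uniq_count_le h1) => x; count_lia.
- by move: h5; rewrite -!size_eq0 !size_rev.
- by move=> c uc cc; rewrite !size_rev; apply: h6.
Qed.

Lemma oadj_path x (s : seq G) : path (@adj G) x s -> path (@oadj G) x s.
Proof. by apply: sub_path => a b; apply: adj_oadj. Qed.

Section Config.
Variables (u v : G) (Z A B : seq G).
Hypothesis th : theta u v Z A B.

Lemma theta_absurd (c s : seq G) :
    cycle (@oadj G) c -> perm_eq c s ->
    (forall x, count_mem x s <= count_mem x [:: u, v & Z ++ A ++ B]) ->
    size A + size B + 2 < size s ->
  False.
Proof.
move=> cc cs le_s; rewrite -(perm_size cs) ltnNge => /negP; apply.
apply: (theta_top th) => //; apply: (uniq_count_le (theta_uniq th)) => x.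
by have /= -> := permP cs (pred1 x).
Qed.

Lemma outside_noadj_head w : w \notin [:: u, v & A ++ B] -> oadj u w ->
  ~~ oadj w (head u A).
Proof.
case: th => ut pA pB _ /and3P[_ An Bn] top wo uw; apply/negP => wa.
have uw' : uniq [:: w, u, v & A ++ B].
  rewrite cons_uniq wo; apply: (uniq_count_le ut) => x.
  by count_lia.
have [a [A' EA]] : exists a A', A = a :: A' by case: (A) An => // a A' _; exists a, A'.
rewrite EA /= in wa.
have pA' : path (@oadj G) a (rcons A' v).
  by apply: oadj_path; move: pA; rewrite EA => /andP[].
have cc : cycle (@oadj G) [:: u, w, a & A' ++ v :: rev B].
  rewrite /= uw wa path_split pA' /= -path_rev; last exact: oadj_sym.
  exact: oadj_path.
have /top/(_ cc) : uniq [:: u, w, a & A' ++ v :: rev B].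
  apply: (uniq_count_le uw') => x.
  by rewrite EA; count_lia.
by rewrite EA; count_lia.
Qed.

Lemma strand_exit_noadj A1 p' A2 B1 B2 :
    A = A1 ++ p' :: A2 -> B = B1 ++ B2 -> B1 != [::] ->
    pcover (@oadj G) (u :: A1 ++ B1) u (last u B1) ->
    oadj (last u A) (last u B) ->
  [/\ {in Z, forall y, ~~ oadj p' y}, ~~ oadj p' v & ~~ oadj p' (last u B)].
Proof.
move=> EA EB; case/lastP: B1 EB => // B1 q; rewrite last_rcons => EB _ cS hv.
have [ut pA pB pZ Zn top] := th.
have o_sym := @oadj_sym G.
have [pA1 pA2] : path (@adj G) u (rcons A1 p') /\ path (@adj G) p' (rcons A2 v).
  by move: pA; rewrite EA path_split => /andP.
have [pB1 pB2] : path (@adj G) u (rcons B1 q) /\ path (@adj G) q (rcons B2 v).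
  by move: pB; rewrite EB cat_rcons path_split => /andP.
have pA2' := oadj_path pA2; have pB2' := oadj_path pB2; have pZ' := oadj_path pZ.
have lA : last u A = last p' A2 by rewrite EA last_cat.
have lB : last u B = last q B2 by rewrite EB last_cat last_rcons.
have cS' := pcover_sym o_sym cS.
have Zpos : 0 < size Z by case/andP: Zn; rewrite -size_eq0 lt0n.
have pq : path (@oadj G) q B2 by move: pB2'; rewrite rcons_path => /andP[].
have pp : path (@oadj G) p' A2 by move: pA2'; rewrite rcons_path => /andP[].
have szS : size (u :: A1 ++ rcons B1 q) = (size A1 + size B1).+2.
  by rewrite /= size_cat size_rcons addnS.
have szA : size A = size A1 + (size A2).+1 by rewrite EA size_cat.
have szB : size B = (size B1 + size B2).+1 by rewrite EB size_cat size_rcons.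
have absurd M : path (@oadj G) u (rcons M q) ->
    (forall x, count_mem x M <=
       (v == x) + count_mem x Z + (p' == x) + count_mem x A2 + count_mem x B2) ->
    size A2 + size B2 + 2 < size M -> False.
  move=> pM cM sM; have [c cc pc] := pcover_close cS' pM.
  apply: (theta_absurd cc pc) => [x|]; last by move: sM szS szA szB; count_lia.
  by have := cM x; rewrite EA EB; count_lia.
split.
- move=> y /splitPr yZ; apply/negP => py.
  case: yZ pZ' Zpos absurd => Z1 Z2; rewrite path_split => /andP[pZ1 _] _ absurd.
  apply: (absurd (Z1 ++ y :: p' :: A2 ++ v :: rev B2)).
  + rewrite path_split pZ1 /= oadj_sym py path_split pA2' -path_rev //.
  + by move=> x; count_lia.
  + by count_lia.
- apply/negP => pv; apply: (absurd (Z ++ v :: p' :: A2 ++ rev B2)).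
  + rewrite path_split pZ' /= oadj_sym pv rcons_cat cat_path pp /=.
    by apply: path_rev_link; rewrite // -lA -lB.
  + by move=> x; count_lia.
  + by move: Zpos; count_lia.
- apply/negP => pb; apply: (absurd (Z ++ v :: rev A2 ++ p' :: rev B2)).
  + rewrite path_split pZ' path_split -path_rev // pA2' /=.
    by apply: path_rev_link; rewrite // -lB.
  + by move=> x; count_lia.
  + by move: Zpos; count_lia.
Qed.

Lemma strands_meet_absurd A1 B1 B2 Ar Br :
    A = A1 ++ Ar -> B = B1 ++ B2 ++ Br -> B1 != [::] -> Br != [::] ->
    pcover (@oadj G) (u :: A1 ++ B1) u (last u B1) ->
    pcover (@oadj G) (v :: Ar ++ Br) (head v Br) v ->
  False.
Proof.
move=> EA EB; case/lastP: B1 EB => // B1 q; rewrite last_rcons => EB _.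
case: Br EB => // b Br EB _ /= cS [s' [pS' [l [El pl ll]]]].
have o_sym := @oadj_sym G.
have [ut pA pB pZ Zn top] := th.
have Zpos : 0 < size Z by case/andP: Zn; rewrite -size_eq0 lt0n.
have pq : path (@adj G) q (rcons B2 b).
  move: pB; rewrite EB cat_rcons path_split => /andP[_].
  by rewrite path_split => /andP[].
have pM : path (@oadj G) q (rcons (B2 ++ b :: l ++ rev Z) u).
  rewrite path_split (oadj_path pq) rcons_cat cat_path pl ll /=.
  by rewrite -path_rev //; apply: oadj_path.
have [c cc pc] := pcover_close cS pM.
have cM x : count_mem x (b :: l) = count_mem x (v :: Ar ++ b :: Br).
  by rewrite -El; have /= -> := permP pS' (pred1 x).
have sM : size (b :: l) = size (v :: Ar ++ b :: Br) by rewrite -El (perm_size pS').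
apply: (theta_absurd cc pc) => [x|].
  have := cM x; rewrite EA EB -cats1; count_lia.
move: sM Zpos; rewrite EA EB; count_lia.
Qed.
End Config.
End Theta.

Lemma head_rev (T : Type) (x : T) s : head x (rev s) = last x s.
Proof. by case/lastP: s => // s y; rewrite rev_rcons last_rcons. Qed.

Section Grow.
Variable G : sgraph.
Hypothesis claw_heavy : graph_heavy claw G.
Hypothesis wounded_heavy : graph_heavy wounded G.

Lemma theta_heads_oadj (u v : G) Z A B : theta u v Z A B ->
  oadj (head u A) (head u B).
Proof.
move=> th; have [ut pA pB pZ Zn top] := th.
case: Z A B Zn th ut pA pB pZ {top} => [|z Z] // [|a A] // [|b B] // _ th ut.
move=> /andP[ua _] /andP[ub _] /andP[uz _].
have zo : z \notin [:: u, v & (a :: A) ++ b :: B].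
  have : uniq [:: z, u, v & (a :: A) ++ b :: B].
    by apply: (uniq_count_le ut) => x; count_lia.
  by case/andP.
have zo' : z \notin [:: u, v & (b :: B) ++ a :: A].
  by move: zo; rewrite !inE !mem_cat !inE [(z == b) || _]orbC; do !case: (_ == _); do !case: (_ \in _).
have uz' := adj_oadj uz.
have u4 : uniq [:: z; a; b] by apply: (uniq_count_le ut) => x; count_lia.
have := @claw_oadj G claw_heavy u z a b uz ua ub; apply.
- by move: u4; rewrite /= !inE negb_or => /and3P[/andP[]].
- by move: u4; rewrite /= !inE negb_or => /and3P[/andP[]].
- by move: u4; rewrite /= !inE => /and3P[_].
- exact: (outside_noadj_head th zo uz').
- exact: (outside_noadj_head (theta_swap th) zo' uz').
Qed.

Lemma theta_lasts_oadj (u v : G) Z A B : theta u v Z A B ->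
  oadj (last u A) (last u B).
Proof.
move=> th; have [_ _ _ _ /and3P[_ An Bn] _] := th.
have := theta_heads_oadj (theta_rev th); rewrite !head_rev.
by case: A B An Bn {th} => [|a A] // [|b B].
Qed.

(* The vertex [nth v Z 1] is the second one of the path [Z] followed by [v]. *)
Definition chain_ok (u v : G) (Z : seq G) :=
  (exists z, Z = [:: z] /\ adj u v) \/ ~~ oadj u (nth v Z 1).

Definition clean_hub (u v : G) (Z A B A1 B1 : seq G) :=
  [/\ (A1 != [::]) && (B1 != [::]),
      hub (@oadj G) (u :: A1 ++ B1) u (last u A1) (last u B1),
      {in u :: A1 ++ B1 &, forall x y, oadj x y -> adj x y},
      {in A1 ++ B1, forall x, ~~ oadj x v /\ {in Z, forall y, ~~ oadj x y}}
    & {in A1, forall x, ~~ oadj x (last u B)} /\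
      {in B1, forall x, ~~ oadj x (last u A)}].

Lemma perm_strands (u : G) A1 B1 : perm_eq (u :: A1 ++ B1) (u :: B1 ++ A1).
Proof. by rewrite perm_cons perm_catC. Qed.

Lemma clean_hub_swap u v Z A B A1 B1 :
  clean_hub u v Z A B A1 B1 -> clean_hub u v Z B A B1 A1.
Proof.
move=> [n h c f [g1 g2]]; split=> //.
- by rewrite andbC.
- apply: hub_perm (perm_strands _ _ _) _; apply: hub_sym h; exact: oadj_sym.
- by move=> x y; rewrite -!(perm_mem (perm_strands u A1 B1)); apply: c.
- by move=> x; rewrite mem_cat orbC -mem_cat; apply: f.
Qed.

Definition defective_hub (u : G) (A1 B1 : seq G) :=
  [/\ (A1 != [::]) && (B1 != [::]),
      hub (@oadj G) (u :: A1 ++ B1) u (last u A1) (last u B1) &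
      hub_defect (@oadj G) (@defect G) (u :: A1 ++ B1) u (last u A1) (last u B1)].

Lemma defective_hub_swap u A1 B1 : defective_hub u A1 B1 -> defective_hub u B1 A1.
Proof.
have o_sym := @oadj_sym G.
move=> [n h d]; split.
- by rewrite andbC.
- by apply: hub_perm (perm_strands _ _ _) _; apply: hub_sym h.
- by apply: hub_defect_perm (perm_strands _ _ _) _; apply: hub_defect_sym d.
Qed.

Lemma clean_hub_grow u v Z A B A1 p' A2 B1 B2 x :
    theta u v Z A B -> A = A1 ++ p' :: A2 -> B = B1 ++ B2 ->
    clean_hub u v Z A B A1 B1 ->
    x \in u :: A1 ++ B1 -> x != last u A1 -> oadj p' x ->
  defective_hub u (rcons A1 p') B1 \/ clean_hub u v Z A B (rcons A1 p') B1.
Proof.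
move=> th EA EB [n h cl f [g1 g2]] xS xp p'x.
have o_sym := @oadj_sym G.
have [ut pA _ _ _ _] := th.
have pp' : adj (last u A1) p'.
  by move: pA; rewrite EA path_split rcons_path => /andP[/andP[]].
have pS : perm_eq (p' :: u :: A1 ++ B1) (u :: rcons A1 p' ++ B1).
  by apply/permP => a; rewrite -cats1; count_lia.
have n' : (rcons A1 p' != [::]) && (B1 != [::]).
  by case/andP: n => _ ->; rewrite andbT -size_eq0 size_rcons.
have h' : hub (@oadj G) (u :: rcons A1 p' ++ B1) u (last u (rcons A1 p')) (last u B1).
  rewrite last_rcons; apply: (hub_perm pS).
  exact: (hub_grow o_sym h xS xp (adj_oadj pp') p'x).
have [[y [yS yp d]] | nd] :=
    classic (exists y, [/\ y \in u :: A1 ++ B1, y != last u A1 & defect p' y]).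
  left; split=> //; rewrite last_rcons; apply: (hub_defect_perm pS).
  exact: (hub_grow_defect o_sym h yS yp (adj_oadj pp') d).
right.
have p'S y : y \in u :: A1 ++ B1 -> oadj p' y -> adj p' y.
  move=> yS; rewrite /oadj => /orP[// | d].
  have [yp | yp] := eqVneq y (last u A1); first by rewrite yp adj_sym.
  by case: nd; exists y.
have [||fZ fv fB] := strand_exit_noadj th EA EB _ _ (theta_lasts_oadj th).
  by case/andP: n.
  by case: h.
split=> //.
- move=> a b; rewrite -!(perm_mem pS) inE [b \in _ :: _]inE.
  case/predU1P => [-> | aS] /predU1P[-> | bS]; first by rewrite oadj_irrefl.
  + exact: p'S.
  + by rewrite oadj_sym adj_sym; apply: p'S.
  + exact: cl.
- move=> a; rewrite mem_cat mem_rcons inE -orbA -mem_cat.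
  by case/predU1P => [-> // | aS]; apply: f.
- by split=> // a; rewrite mem_rcons inE => /predU1P[-> // | aS]; apply: g1.
Qed.

Lemma first_nonneighbour (u : G) s : s != [::] -> adj u (head u s) -> ~~ adj u (last u s) ->
  exists s1 y w s2, [/\ s = s1 ++ y :: w :: s2, adj u y & ~~ adj u w].
Proof.
elim: s => // a [|b s] IHs _ /= ua nl; first by rewrite ua in nl.
have [ub | nub] := boolP (adj u b); last by exists [::], a, b, s.
by have [s1 [y [w [s2 [-> uy uw]]]]] := IHs isT ub nl; exists (a :: s1), y, w, s2.
Qed.

Lemma clean_hub_blocked u v Z A B A1 p' A2 B1 q' B2 :
    theta u v Z A B -> chain_ok u v Z ->
    A = A1 ++ p' :: A2 -> B = B1 ++ q' :: B2 ->
    clean_hub u v Z A B A1 B1 ->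
    {in u :: A1 ++ B1, forall x, x != last u A1 -> ~~ oadj p' x} ->
    {in u :: A1 ++ B1, forall x, x != last u B1 -> ~~ oadj q' x} ->
  False.
Proof.
move=> th ch EA EB st np' nq'.
have [n h cl f [g1 g2]] := st.
have [ut pA pB pZ Zn _] := th.
case/andP: n => A1n B1n.
have thl := theta_lasts_oadj th.
have [fZ fv fB] := strand_exit_noadj th EA EB B1n (let: And4 a b c d := h in b) thl.
have [gZ gv gA] : [/\ {in Z, forall y, ~~ oadj q' y}, ~~ oadj q' v & ~~ oadj q' (last u A)].
  apply: (strand_exit_noadj (theta_swap th) EB EA A1n).
    by apply: pcover_perm (perm_strands _ _ _) _; case: h.
  by rewrite oadj_sym.
have [pA1 pp'] : path (@adj G) u A1 /\ adj (last u A1) p'.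
  by move: pA; rewrite EA path_split rcons_path => /andP[/andP[]].
have [pB1 qq'] : path (@adj G) u B1 /\ adj (last u B1) q'.
  by move: pB; rewrite EB path_split rcons_path => /andP[/andP[]].
have lastin (s : seq G) : s != [::] -> last u s \in s.
  by case: s => // a s _; rewrite /= mem_last.
have up : u != last u A1.
  apply: contraTneq (lastin _ A1n) => <-; apply/negP => uA.
  by move: ut; rewrite EA /= !inE !mem_cat uA !orbT.
case: ch => [[z [EZ uv]] | nz2].
  subst Z.
  have [s1 [y [w [s2 [Es uy uw]]]]] :
      exists s1 y w s2, [/\ rcons A1 p' = s1 ++ y :: w :: s2, adj u y & ~~ adj u w].
    apply: first_nonneighbour; first by rewrite -size_eq0 size_rcons.
      by case: (A1) A1n pA1 => // a A1' _ /andP[].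
    rewrite last_rcons adj_sym; apply: contra (np' u _ up); first exact: adj_oadj.
    by rewrite inE eqxx.
  have yA1 : y \in A1.
    have : rcons A1 p' = rcons (s1 ++ y :: belast w s2) (last w s2).
      by rewrite Es rcons_cat rcons_cons -lastI.
    by case/rcons_inj => -> _; rewrite mem_cat inE eqxx orbT.
  have yS : y \in u :: A1 ++ B1 by rewrite inE mem_cat yA1 orbT.
  have wA1 : w = p' \/ w \in A1.
    have : w \in rcons A1 p' by rewrite Es mem_cat !inE eqxx !orbT.
    by rewrite mem_rcons inE => /predU1P[]; [left | right].
  have [wv wz wB] : [/\ ~~ oadj w v, ~~ oadj w z & ~~ oadj w (last u B)].
    case: wA1 => [-> | wA]; first by split=> //; apply: fZ; rewrite inE.
    have [|h1 h2] := f w; first by rewrite mem_cat wA.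
    by split=> //; [apply: h2; rewrite inE | apply: g1].
  have ouw : ~~ oadj u w.
    case: wA1 => [E | wA]; first by rewrite E oadj_sym np' // inE eqxx.
    by apply: contra uw; apply: cl; rewrite inE ?eqxx // mem_cat wA orbT.
  have [yv yz] : ~~ oadj y v /\ ~~ oadj y z.
    have [|h1 h2] := f y; first by rewrite mem_cat yA1.
    by split=> //; apply: h2; rewrite inE.
  have yw : adj y w.
    have : path (@adj G) u (rcons A1 p') by rewrite rcons_path pA1.
    by rewrite Es cat_path /= => /and3P[_ _ /andP[]].
  have [uz zv] : adj u z /\ adj z v by move: pZ => /= /and3P[].
  set b := last u B.
  have bv : adj b v by move: pB; rewrite rcons_path => /andP[].
  have thr := theta_swap (theta_rev th).
  have [bZ bu] : {in rev [:: z], forall y, ~~ oadj b y} /\ ~~ oadj b u.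
    have [a [A' [ra va]]] : exists a A', rev A = a :: A' /\ adj v a.
      have := theta_A (theta_rev th); have /and3P[_] := theta_nil (theta_rev th).
      by case: (rev A) => // a A' _ _ /andP[va _]; exists a, A'.
    have [B' rb] : exists B', rev B = [::] ++ b :: B'.
      have /and3P[_ _] := theta_nil (theta_rev th).
      rewrite /b -head_rev; case: (rev B) => // b' B' _; by exists B'.
    have [] // := @strand_exit_noadj _ _ _ _ _ _ thr [::] b B' [:: a] A' rb ra.
      exists [:: v; a]; split=> //; exists [:: a].
      by rewrite /= adj_oadj.
    exact: theta_lasts_oadj thr.
  apply: (@wounded_oadj G wounded_heavy v u z b y w) => //.
  - by rewrite adj_sym.
  - by rewrite adj_sym.
  - by rewrite adj_sym.
  - by rewrite oadj_sym.
  - by rewrite oadj_sym.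
  - by rewrite oadj_sym.
  - by rewrite oadj_sym; apply: bZ; rewrite mem_rev inE.
  - by rewrite oadj_sym.
  - by rewrite oadj_sym.
  - by rewrite oadj_sym; apply: g1.
  - by rewrite oadj_sym.
case: Z Zn th pZ ut st f fZ gZ nz2 => [|z1 Z] // _ th pZ ut st f fZ gZ nz2.
set z2 := nth v (z1 :: Z) 1 in nz2.
have z2E : z2 = v \/ z2 \in Z.
  by rewrite /z2; case: (Z) => [|z Z']; [left | right; rewrite inE eqxx].
have [uz1 z12] : adj u z1 /\ adj z1 z2.
  by move: pZ; rewrite /z2; case: (Z) => [|z Z'] /= /and3P[].
have nz1 w : {in z1 :: Z, forall y, ~~ oadj w y} -> ~~ oadj w z1.
  by apply; rewrite inE eqxx.
have nz2' w : ~~ oadj w v -> {in z1 :: Z, forall y, ~~ oadj w y} -> ~~ oadj w z2.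
  by move=> wv wZ; case: z2E => [-> // | zZ]; apply: wZ; rewrite inE zZ orbT.
apply: (@blocked_hub_absurd G claw_heavy wounded_heavy z2 z1 u A1 B1 p' q') => //.
- have uz : uniq [:: z2, z1, u & A ++ B].
    rewrite /z2; case: (Z) ut => [|z Z'] ut;
      by apply: (uniq_count_le ut) => x; count_lia.
  apply: (uniq_count_le uz) => x; rewrite EA EB; count_lia.
- move=> x xS; have [h1 h2] := f x xS.
  by split; [apply: nz1 | apply: nz2'].
- move=> x; rewrite !in_set 3!inE => /or4P[/eqP-> | /eqP-> | /eqP-> | xS] xp.
  + exact: nz2'.
  + exact: nz1.
  + by apply: np'; rewrite // inE eqxx.
  + by apply: np'; rewrite // inE xS orbT.
- move=> x; rewrite !in_set 3!inE => /or4P[/eqP-> | /eqP-> | /eqP-> | xS] xp.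
  + exact: nz2'.
  + exact: nz1.
  + by apply: nq'; rewrite // inE eqxx.
  + by apply: nq'; rewrite // inE xS orbT.
Qed.

Lemma grow_defective_hub u v Z A B Ar Br :
    theta u v Z A B -> chain_ok u v Z -> Ar != [::] -> Br != [::] ->
    pcover (@oadj G) (v :: Ar ++ Br) (head v Ar) v ->
    pcover (@oadj G) (v :: Ar ++ Br) (head v Br) v ->
  forall A1 A2 B1 B2, A = A1 ++ A2 ++ Ar -> B = B1 ++ B2 ++ Br ->
    clean_hub u v Z A B A1 B1 ->
  exists A1' A2' B1' B2', [/\ A = A1' ++ A2' ++ Ar, B = B1' ++ B2' ++ Br
                           & defective_hub u A1' B1'].
Proof.
move=> th ch Arn Brn cA cB A1 A2 B1 B2.
have [n] := ubnP (size A2 + size B2).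
elim: n A1 A2 B1 B2 => // n IHn A1 A2 B1 B2 le_n EA EB st.
have [n1 h _ _ _] := st; case/andP: n1 => A1n B1n; have [h1 h2 _ _] := h.
case: A2 EA le_n => [|p' A2] EA le_n.
  by case: (strands_meet_absurd th EA EB B1n Brn h2 cB).
case: B2 EB le_n => [|q' B2] EB le_n.
  case: (strands_meet_absurd (theta_swap th) EB EA A1n Arn).
    by apply: pcover_perm (perm_strands _ _ _) h1.
  by apply: pcover_perm (perm_strands _ _ _) cA.
have [[x [xS xp p'x]] | np'] :=
    classic (exists x, [/\ x \in u :: A1 ++ B1, x != last u A1 & oadj p' x]).
  have EA' : A = A1 ++ p' :: A2 ++ Ar by [].
  have EA2 : A = rcons A1 p' ++ A2 ++ Ar by rewrite cat_rcons.
  case: (clean_hub_grow th EA' EB st xS xp p'x) => [d | st'].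
    by exists (rcons A1 p'), A2, B1, (q' :: B2).
  by apply: (IHn (rcons A1 p') A2 B1 (q' :: B2)).
have [[x [xS xq q'x]] | nq'] :=
    classic (exists x, [/\ x \in u :: A1 ++ B1, x != last u B1 & oadj q' x]).
  have EB' : B = B1 ++ q' :: B2 ++ Br by [].
  have EB2 : B = rcons B1 q' ++ B2 ++ Br by rewrite cat_rcons.
  rewrite (perm_mem (perm_strands u A1 B1)) in xS.
  case: (clean_hub_grow (theta_swap th) EB' EA (clean_hub_swap st) xS xq q'x) => [d | st'].
    exists A1, (p' :: A2), (rcons B1 q'), B2; split=> //.
    exact: defective_hub_swap.
  apply: (IHn A1 (p' :: A2) (rcons B1 q') B2) => //.
    by move: le_n; rewrite /= addnS.
  exact: clean_hub_swap.
have EA' : A = A1 ++ p' :: A2 ++ Ar by [].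
have EB' : B = B1 ++ q' :: B2 ++ Br by [].
case: (clean_hub_blocked th ch EA' EB' st) => x xS xn; apply/negP => ox.
  by case: np'; exists x.
by case: nq'; exists x.
Qed.
End Grow.

Section Core.
Variable G : sgraph.
Hypothesis claw_heavy : graph_heavy claw G.
Hypothesis wounded_heavy : graph_heavy wounded G.

Lemma theta_strand_ends (u v : G) Z A B : theta u v Z A B ->
  exists a Am a', A = [:: a] ++ Am ++ [:: a'].
Proof.
move=> th; have [ut pA pB _ Zn _] := th.
case: A B Zn th ut pA pB => [|a A] // [|b B]; rewrite ?andbF // => _ th ut pA pB.
case/lastP: A => [|Am a'] in th ut pA *; last by exists a, Am, a'; rewrite cats1.
have [] // := @strand_exit_noadj _ _ _ _ _ _ th [::] a [::] [:: b] B erefl erefl.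
- exists [:: u; b]; split=> //; exists [:: b].
  by rewrite /= adj_oadj //; case/andP: pB.
- exact: theta_lasts_oadj th.
- by move: pA => /= /and3P[_ /adj_oadj -> _].
Qed.

Lemma base_hub (u v : G) Z a A b B : theta u v Z (a :: A) (b :: B) ->
  defective_hub u [:: a] [:: b] \/ clean_hub u v Z (a :: A) (b :: B) [:: a] [:: b].
Proof.
move=> th; have [ut /= /andP[ua _] /andP[ub _] _ _ _] := th.
have o_sym := @oadj_sym G.
have ab := theta_heads_oadj claw_heavy th.
have hab := hub_base o_sym (adj_oadj ua) (adj_oadj ub) ab.
have [d | nd] := boolP (defect a b).
  left; split=> //=; exists a, b, StrandA, StrandB; split=> //=.
  - by exists [:: a], [:: u; b]; split; [apply/permP => k; count_lia | exact: walk1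
      | exists [:: b]; rewrite /= adj_oadj].
  - by exists [:: b], [:: u; a]; split; [apply/permP => k; count_lia | exact: walk1
      | exists [:: a]; rewrite /= adj_oadj].
  - by rewrite !inE !eqxx !orbT.
have adab : adj a b by move: ab; rewrite /oadj (negbTE nd) orbF.
have thl := theta_lasts_oadj claw_heavy th.
have cov w : adj u w -> pcover (@oadj G) (u :: [:: w]) u w.
  by move=> uw; exists [:: u; w]; split=> //; exists [:: w]; rewrite /= adj_oadj.
have [aZ av aB] := @strand_exit_noadj _ _ _ _ _ _ th [::] a A [:: b] B erefl erefl isT (cov b ub) thl.
have thl' : oadj (last u (b :: B)) (last u (a :: A)) by rewrite oadj_sym.
have [bZ bv bA] := @strand_exit_noadj _ _ _ _ _ _ (theta_swap th) [::] b B [:: a] A erefl erefl isT (cov a ua) thl'.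
right; split=> //.
- move=> x y; rewrite !inE => /or3P[] /eqP -> /or3P[] /eqP -> //;
    by rewrite ?oadj_irrefl // adj_sym.
- by move=> x; rewrite !inE => /orP[] /eqP ->.
- by split=> x; rewrite inE => /eqP ->.
Qed.

Lemma theta_defective_hub (u v : G) Z a Am Ar b Bm Br :
    theta u v Z ([:: a] ++ Am ++ Ar) ([:: b] ++ Bm ++ Br) -> chain_ok u v Z ->
    Ar != [::] -> Br != [::] ->
    pcover (@oadj G) (v :: Ar ++ Br) (head v Ar) v ->
    pcover (@oadj G) (v :: Ar ++ Br) (head v Br) v ->
  exists A1 A2 B1 B2, [/\ [:: a] ++ Am ++ Ar = A1 ++ A2 ++ Ar,
                          [:: b] ++ Bm ++ Br = B1 ++ B2 ++ Br
                        & defective_hub u A1 B1].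
Proof.
move=> th ch Arn Brn cA cB.
case: (base_hub th) => [d | st]; first by exists [:: a], Am, [:: b], Bm.
exact: (grow_defective_hub claw_heavy wounded_heavy th ch Arn Brn cA cB erefl erefl st).
Qed.

Lemma strand_eq_dec (i j : strand) : i = j \/ i <> j.
Proof. by case: i; case: j; auto; right. Qed.

Lemma defective_hubs_absurd (u v : G) Z A B A1 A2 A3 B1 B2 B3 :
    theta u v Z A B -> A = A1 ++ A2 ++ rev A3 -> B = B1 ++ B2 ++ rev B3 ->
    defective_hub u A1 B1 -> defective_hub v A3 B3 -> False.
Proof.
move=> th EA EB [n1 _ [x [y [i [j [ij tx ty d m]]]]]].
move=> [n3 _ [x' [y' [i' [j' [ij' tx' ty' d' m']]]]]].
have [ut pA pB pZ Zn _] := th.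
have o_sym := @oadj_sym G.
have mid (s s1 s2 s3 : seq G) : path (@adj G) u (rcons s v) -> s = s1 ++ s2 ++ rev s3 ->
    s3 != [::] -> path (@oadj G) (last u s1) (rcons s2 (last v s3)).
  move=> ps Es; case/lastP: s3 Es => // s3 a; rewrite last_rcons rev_rcons => Es _.
  apply: oadj_path; move: ps; rewrite Es rcons_cat cat_path => /andP[_].
  by rewrite path_split => /andP[].
have [/andP[_ B3n] /andP[A3n _]] := (n3, n3).
have pA2 := mid _ _ _ _ pA EA A3n; have pB2 := mid _ _ _ _ pB EB B3n.
have Zpos : 0 < size Z by case/andP: Zn; rewrite -size_eq0 lt0n.
have nojoin k l w w' : k <> l ->
    typ (@oadj G) (u :: A1 ++ B1) u (last u A1) (last u B1) k w ->
    typ (@oadj G) (v :: A3 ++ B3) v (last v A3) (last v B3) l w' -> ~~ oadj w w'.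
  move=> kl tw tw'; apply/negP => ww.
  have [c cc [_ pc]] := typ_join o_sym kl tw tw' pA2 pB2 (oadj_path pZ) ww.
  apply: (theta_absurd th cc pc) => [z|]; rewrite EA EB; first by count_lia.
  by move: Zpos; count_lia.
have neq w w' : w \in u :: A1 ++ B1 -> w' \in v :: A3 ++ B3 -> w != w'.
  move=> wS wS'; apply: contraTneq wS' => <-.
  have : uniq ((u :: A1 ++ B1) ++ (v :: A3 ++ B3)).
    by apply: (uniq_count_le ut) => z; rewrite EA EB; count_lia.
  by rewrite cat_uniq => /and3P[_ /hasPn H _]; apply: contraL wS => /H.
have [/andP[xS yS] /andP[xS' yS']] := (m, m').
have direct k l k' l' w w1 w' w1' : k <> k' -> l <> l' ->
    typ (@oadj G) (u :: A1 ++ B1) u (last u A1) (last u B1) k w ->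
    typ (@oadj G) (u :: A1 ++ B1) u (last u A1) (last u B1) l w1 ->
    typ (@oadj G) (v :: A3 ++ B3) v (last v A3) (last v B3) k' w' ->
    typ (@oadj G) (v :: A3 ++ B3) v (last v A3) (last v B3) l' w1' ->
    defect w w1 -> defect w' w1' -> w \in u :: A1 ++ B1 -> w1 \in u :: A1 ++ B1 ->
    w' \in v :: A3 ++ B3 -> w1' \in v :: A3 ++ B3 -> False.
  move=> kk ll tw tw1 tw' tw1' dw dw' wS w1S wS' w1S'.
  by case: (defects_cross dw dw' (neq _ _ wS wS') (neq _ _ w1S w1S')) => H;
    [have := nojoin _ _ _ _ kk tw tw' | have := nojoin _ _ _ _ ll tw1 tw1'];
    rewrite H.
case: (strand_eq_dec i i') => [ii | ii].
  apply: (direct i j j' i' x y y' x') => //; try by rewrite defect_sym.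
    by rewrite ii.
  by move=> ji; apply: ij; rewrite ii ji.
case: (strand_eq_dec j j') => [jj | jj].
  apply: (direct i j j' i' x y y' x') => //; try by rewrite defect_sym.
    by rewrite -jj.
  by rewrite jj => /esym.
exact: (direct i j i' j' x y x' y').
Qed.

Lemma theta_chains_absurd (u v : G) Z A B :
  theta u v Z A B -> chain_ok u v Z -> chain_ok v u (rev Z) -> False.
Proof.
move=> th ch chr; have thr := theta_rev th.
have o_sym := @oadj_sym G.
have [a [Am [a' EA]]] := theta_strand_ends th.
have [b [Bm [b' EB]]] := theta_strand_ends (theta_swap th).
have rA : rev A = [:: a'] ++ rev Am ++ [:: a] by rewrite EA !rev_cat -catA.
have rB : rev B = [:: b'] ++ rev Bm ++ [:: b] by rewrite EB !rev_cat -catA.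
have [ua ub] : adj u a /\ adj u b.
  have [_ pA pB _ _ _] := th.
  by move: pA pB; rewrite EA EB => /andP[? _] /andP[? _].
have ab : oadj a b by have := theta_heads_oadj claw_heavy th; rewrite EA EB.
have tri p q : adj u p -> adj u q -> oadj p q -> pcover (@oadj G) [:: u; q; p] p u.
  move=> up uq pq; exists [:: p; q; u]; split; first by apply/permP => k; count_lia.
  by exists [:: q; u]; rewrite /= pq adj_oadj // adj_sym.
have [A3 [A2 [B3 [B2 [EA3 EB3 d3]]]]] :
    exists A1 A2 B1 B2, [/\ rev A = A1 ++ A2 ++ [:: a], rev B = B1 ++ B2 ++ [:: b]
                          & defective_hub v A1 B1].
  rewrite rA rB; apply: (@theta_defective_hub v u (rev Z)) => //.
  - by rewrite -rA -rB.
  - by apply: pcover_perm (tri a b ua ub ab); apply/permP => k; count_lia.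
  - by apply: pcover_perm (tri b a ub ua _); [apply/permP => k; count_lia | rewrite o_sym].
have EA' : A = [:: a] ++ rev A2 ++ rev A3 by rewrite -[A]revK EA3 !rev_cat -catA.
have EB' : B = [:: b] ++ rev B2 ++ rev B3 by rewrite -[B]revK EB3 !rev_cat -catA.
have [/andP[A3n B3n] [hA3 hB3 _ _] _] := d3.
have rn (s : seq G) : s != [::] -> rev s != [::] by rewrite -!size_eq0 size_rev.
have pr : perm_eq (v :: A3 ++ B3) (v :: rev A3 ++ rev B3).
  by apply/permP => k; count_lia.
have [A1 [A2' [B1 [B2' [EA1 EB1 d1]]]]] :
    exists A1 A2 B1 B2, [/\ A = A1 ++ A2 ++ rev A3, B = B1 ++ B2 ++ rev B3
                          & defective_hub u A1 B1].
  rewrite EA' EB'; apply: (@theta_defective_hub u v Z) => //; try exact: rn.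
  - by rewrite -EA' -EB'.
  - by rewrite head_rev; apply: pcover_perm pr _; apply: pcover_sym hA3.
  - by rewrite head_rev; apply: pcover_perm pr _; apply: pcover_sym hB3.
exact: (defective_hubs_absurd th EA1 EB1 d1 d3).
Qed.
End Core.

Lemma clique_path (T : eqType) (r : rel T) x s :
  uniq (x :: s) -> {in x :: s &, forall a b, a != b -> r a b} -> path r x s.
Proof.
elim: s x => //= y s IHs x /andP[xs us] H.
rewrite H ?inE ?eqxx ?orbT //=; last first.
  by apply: contraNneq xs => ->; rewrite inE eqxx.
by apply: IHs => // a b aS bS; apply: H; rewrite inE ?aS ?bS orbT.
Qed.

(* The indices of [Y], those of [X] shifted by [q], and [0 .. q - 1] are disjoint. *)
Lemma gap_count (T : Type) (X Y : pred T) (x0 : T) s q : 0 < q -> s <> [::] ->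
    (forall s1 x m y s2, s = s1 ++ x :: m ++ y :: s2 -> X x -> Y y -> q <= size m) ->
    X (head x0 s) -> ~~ Y (head x0 s) -> ~~ X (last x0 s) -> Y (last x0 s) ->
  count X s + count Y s + q <= size s.
Proof.
move=> q0 sn gap Xh Yh Xl Yl; pose m := size s.
have m0 : 0 < m by rewrite /m; case: (s) sn.
have gapn i j : i < j < m -> X (nth x0 s i) -> Y (nth x0 s j) -> i + q < j.
  move=> /andP[ij jm] Xi Yj.
  have E : s = take i s ++ nth x0 s i :: (take (j - i.+1) (drop i.+1 s)) ++ nth x0 s j :: drop j.+1 s.
    have im : i < m by apply: ltn_trans jm.
    rewrite -{1}(cat_take_drop i s) (drop_nth x0 im); congr (_ ++ _ :: _).
    rewrite -{1}(cat_take_drop (j - i.+1) (drop i.+1 s)) drop_drop subnK //.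
    by rewrite (drop_nth x0 jm).
  have := gap _ _ _ _ _ E Xi Yj; rewrite size_take size_drop -/m.
  by case: ifP => C; lia.
have cnt P : count P s = size [seq i <- iota 0 m | P (nth x0 s i)].
  by rewrite size_filter -{1}(mkseq_nth x0 s) count_map.
pose L := [seq i + q | i <- [seq i <- iota 0 m | X (nth x0 s i)]] ++
          [seq i <- iota 0 m | Y (nth x0 s i)] ++ iota 0 q.
have lastE : last x0 s = nth x0 s m.-1 by rewrite nth_last.
have headE : head x0 s = nth x0 s 0 by rewrite nth0.
have Xq i : X (nth x0 s i) -> i < m -> i + q < m.-1.
  move=> Xi im; apply: gapn => //; last by rewrite -lastE.
  have : i != m.-1 by apply: contraNneq Xl => im1; rewrite lastE -im1.
  by lia.
have uL : uniq L.
  rewrite !cat_uniq map_inj_uniq ?filter_uniq ?iota_uniq //=; last exact: addIn.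
  rewrite andbT; apply/andP; split; apply/hasPn => j.
    rewrite mem_cat mem_filter !mem_iota => /orP[/andP[Yj /andP[_ jm]] | jq]; last first.
      by apply/mapP => -[i _ ji]; lia.
    apply/mapP => -[i]; rewrite mem_filter mem_iota => /andP[Xi /andP[_ im]] ji.
    suff : i + q < j by lia.
    by apply: gapn => //; lia.
  rewrite mem_iota => /andP[_ jq]; rewrite /= mem_filter mem_iota negb_and.
  apply/orP; left; apply/negP => Yj.
  have [j0 | j0] := posnP j; first by rewrite j0 -headE (negbTE Yh) in Yj.
  have jm : j < m.
    apply: leq_trans jq _; have := Xq 0; rewrite -headE; move/(_ Xh m0); lia.
  have := gapn 0 j; rewrite -headE j0 jm => /(_ isT Xh Yj); lia.
have := uniq_leq_size uL (s2 := iota 0 m); rewrite !size_cat !size_map !size_iota -!cnt.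
rewrite addnA; apply => j; rewrite !mem_cat => /or3P[/mapP[i]||].
- by rewrite mem_filter mem_iota => /andP[Xi /andP[_ im]] ->; rewrite mem_iota; have := Xq _ Xi im; lia.
- by rewrite mem_filter => /andP[].
- rewrite !mem_iota => /andP[_ jq]; have := Xq 0; rewrite -headE; move/(_ Xh m0); lia.
Qed.

Section Chain.
Variable G : sgraph.
Hypothesis claw_heavy : graph_heavy claw G.

Lemma outside_clique (u v : G) Z A B x y : theta u v Z A B ->
    x \notin [:: u, v & A ++ B] -> y \notin [:: u, v & A ++ B] ->
    adj u x -> adj u y -> x != y -> oadj x y.
Proof.
move=> th xS yS ux uy xy.
have := outside_noadj_head th xS (adj_oadj ux).
have := outside_noadj_head th yS (adj_oadj uy).
have [_ pA _ _ /and3P[_ An _] _] := th.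
case: A An pA xS yS {th} => // a A _ /andP[ua _] xS yS /= nya nxa.
have aS : a \in [:: u, v & (a :: A) ++ B] by rewrite !inE eqxx !orbT.
apply: (@claw_oadj G claw_heavy u a x y) => //; try by rewrite oadj_sym.
- by apply: contraNneq xS => <-.
- by apply: contraNneq yS => <-.
Qed.

Definition outer_common (s : seq G) (x y : G) :=
  ([set w | adj x w] :\: [set w in s]) :&: ([set w | adj y w] :\: [set w in s]).

Lemma outer_commonP s x y w :
  reflect [/\ adj x w, adj y w & w \notin s] (w \in outer_common s x y).
Proof.
rewrite !inE; apply: (iffP idP).
  by case/andP=> /andP[ws xw] /andP[_ yw].
by case=> -> -> ->.
Qed.

Lemma degree_sum_outer (s s' : seq G) (x y : G) : uniq (s ++ s') ->
    {in s', forall w, ~~ adj x w && ~~ adj y w} ->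
  degree x + degree y + size s + size s' <=
  count (adj x) s + count (adj y) s + #|outer_common s x y| + #|G|.
Proof.
move=> us ns'.
have us1 : uniq s by move: us; rewrite cat_uniq => /andP[].
rewrite (degree_split x us1) (degree_split y us1).
set X := _ :\: [set w in s]; set Y := _ :\: [set w in s] in us ns' *.
have -> : outer_common s x y = X :&: Y by [].
have : #|X :|: Y| + size (s ++ s') <= #|G|.
  rewrite -(card_uniqP us) -(cardsE (mem (s ++ s'))) -cardsUI.
  suff -> : (X :|: Y) :&: [set w in mem (s ++ s')] = set0.
    by rewrite cards0 addn0 max_card.
  apply/setP => w; rewrite !inE mem_cat; apply/negbTE/negP.
  case/andP=> /orP[] /andP[ws xw] /orP[ws' | /ns']; rewrite ?xw ?andbF //.
    by rewrite ws' in ws.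
  by rewrite ws' in ws.
have := cardsUI X Y; rewrite size_cat; lia.
Qed.

Lemma outer_path (u v : G) Z A B w :
    let s := [:: u, v & A ++ B] in
    theta u v Z A B -> 0 < #|outer_common s u w| ->
  walk (@oadj G) (head u (enum (outer_common s u w))) (enum (outer_common s u w))
       (last u (enum (outer_common s u w))).
Proof.
move=> s th; rewrite cardE.
have : {in enum (outer_common s u w) &, forall a b, a != b -> oadj a b}.
  move=> a b; rewrite !mem_enum => /outer_commonP[ua _ aS] /outer_commonP[ub _ bS].
  exact: outside_clique th aS bS ua ub.
have := enum_uniq (outer_common s u w).
case: (enum _) => // a l ul cl _; exists l; split=> //.
exact: clique_path.
Qed.

(* With the strand [A] interrupted between a neighbour of [u] and a neighbour of
   [v], the common outer neighbours of [u] and [v] close a new cycle. *)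
Lemma strand_gap (u v : G) Z A B s1 x m y s2 :
    let q := #|outer_common [:: u, v & A ++ B] u v| in
    theta u v Z A B -> 0 < q -> A = s1 ++ x :: m ++ y :: s2 ->
    adj u x -> adj v y -> q <= size m.
Proof.
move=> q th q0 EA ux vy.
have o_sym := @oadj_sym G.
have [ut pA pB _ /and3P[_ An Bn] top] := th.
pose Q := enum (outer_common [:: u, v & A ++ B] u v).
have wQ := outer_path th q0; rewrite -/Q in wQ.
have QS w : w \in Q -> [/\ adj u w, adj v w & w \notin [:: u, v & A ++ B]].
  by rewrite mem_enum => /outer_commonP.
have Qn : Q != [::] by rewrite -size_eq0 -cardE -lt0n.
have [hQ lQ] : head u Q \in Q /\ last u Q \in Q.
  by case: (Q) Qn => // a l _; rewrite inE eqxx /= mem_last.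
have [b [B' EB]] : exists b B', B = b :: B' by case: (B) Bn => // b B' _; exists b, B'.
have [a [A' EA']] : exists a A', A = a :: A' by case: (A) An => // a A' _; exists a, A'.
have hub_u := theta_heads_oadj claw_heavy th.
have hub_v := theta_lasts_oadj claw_heavy th.
have wB : walk (@oadj G) b B (last u B).
  rewrite EB; exists B'; split=> //; apply: oadj_path.
  by move: pB; rewrite EB /= rcons_path => /and3P[].
have wA : walk (@oadj G) a A (last u A).
  rewrite EA'; exists A'; split=> //; apply: oadj_path.
  by move: pA; rewrite EA' /= rcons_path => /and3P[].
have EA1 : A = rcons s1 x ++ m ++ y :: s2 by rewrite cat_rcons.
have EA2 : A = (s1 ++ x :: m) ++ y :: s2 by rewrite -catA.
have w1 : walk (@oadj G) a (rcons s1 x) x.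
  move: wA; rewrite EA1; case: (m) => [|c m'] /=; by case/walk_uncat.
have w2 : walk (@oadj G) y (y :: s2) (last u A).
  move: (wA); rewrite {1}EA2; case/lastP: (s1 ++ x :: m) => [|s3 c].
    by move=> [l [El pl ll]]; case: El => ya sl; exists l; rewrite ya sl.
  by case/walk_uncat.
have [c cc pc] : exists2 c, cycle (@oadj G) c &
    perm_eq c (u :: rcons s1 x ++ B ++ (y :: s2) ++ v :: Q).
  have W1 : walk (@oadj G) u (u :: rev (rcons s1 x)) a.
    apply: walk_cat (walk1 _ u) _ (walk_rev o_sym w1); exact: adj_oadj.
  have W2 : walk (@oadj G) u ((u :: rev (rcons s1 x)) ++ B) (last u B).
    by apply: walk_cat W1 _ wB; move: hub_u; rewrite EA' EB.
  have W3 : walk (@oadj G) u (((u :: rev (rcons s1 x)) ++ B) ++ rev (y :: s2)) y.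
    by apply: walk_cat W2 _ (walk_rev o_sym w2); rewrite o_sym.
  have W4 := walk_rcons W3 (adj_oadj (_ : adj y v)); rewrite adj_sym in W4.
  have W5 := walk_cat (W4 vy) (adj_oadj (let: And3 _ p _ := QS _ hQ in p)) wQ.
  have := walk_cycle (m := [::]) W5; rewrite cats0 => W6.
  eexists; first by apply: W6; rewrite /= adj_oadj // adj_sym; case: (QS _ lQ).
  by apply/permP => k; rewrite -!cats1; count_lia.
have ucQ : uniq ([:: u, v & A ++ B] ++ Q).
  rewrite cat_uniq enum_uniq andbT; apply/andP; split.
    by apply: (uniq_count_le ut) => w; count_lia.
  by apply/hasPn => w /QS[].
have /top/(_ cc) : uniq c.
  rewrite (perm_uniq pc); apply: (uniq_count_le ucQ) => w.
  by rewrite EA -!cats1; count_lia.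
rewrite (perm_size pc) /q cardE -/Q EA; count_lia.
Qed.
Lemma head_noadj (u v : G) Z A B : theta u v Z A B -> ~~ oadj (head u A) v.
Proof.
move=> th; have [_ pA pB _ /and3P[_ An Bn] _] := th.
have thl := theta_lasts_oadj claw_heavy th.
case: A An th pA thl => // a A _ th pA thl; case: B Bn th pB thl => // b B _ th pB thl.
have [] // := @strand_exit_noadj _ _ _ _ _ _ th [::] a A [:: b] B erefl erefl isT _ thl.
exists [:: u; b]; split=> //; exists [:: b].
by move: pB => /= /andP[/adj_oadj -> _].
Qed.

Lemma theta_ends_adj (u v : G) Z A B : theta u v Z A B ->
  [/\ adj u (head u A), adj v (last u A), ~~ adj v (head u A) & ~~ adj u (last u A)].
Proof.
move=> th; have h1 := head_noadj th; have h2 := head_noadj (theta_rev th).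
have [_ pA _ _ /and3P[_ An _] _] := th.
split.
- by case: (A) An pA => // a A' _ /andP[].
- by move: pA; rewrite rcons_path adj_sym => /andP[].
- by apply: contra h1; rewrite adj_sym; apply: adj_oadj.
- apply: contra h2; rewrite head_rev adj_sym.
  by case: (A) An => // a A' _ /=; apply: adj_oadj.
Qed.

Lemma chain_one (u v z : G) A B : theta u v [:: z] A B -> chain_ok u v [:: z].
Proof.
move=> th; have [ut pA pB pZ /and3P[_ An Bn] top] := th.
have [uv | nuv] := boolP (adj u v); first by left; exists z.
right; apply/negP; rewrite /= /oadj (negbTE nuv) => /and3P[_ _ duv].
pose q := #|outer_common [:: u, v & A ++ B] u v|.
have q0 : 0 < q.
  apply/card_gt0P; exists z; apply/outer_commonP; move: pZ => /= /and3P[uz zv _].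
  split; rewrite // 1?adj_sym //.
  have : uniq (z :: [:: u, v & A ++ B]) by apply: (uniq_count_le ut) => w; count_lia.
  by case/andP.
have EQ : outer_common [:: u, v & B ++ A] u v = outer_common [:: u, v & A ++ B] u v.
  by apply/setP => w; rewrite !inE !mem_cat ![(w \in B) || _]orbC.
have cA : count (adj u) A + count (adj v) A + q <= size A.
  have [a1 a2 a3 a4] := theta_ends_adj th.
  apply: (@gap_count _ _ _ u) => //; first by move/eqP; rewrite (negbTE An).
  by move=> s1 x m y s2 EA; apply: (strand_gap th q0 EA).
have cB : count (adj u) B + count (adj v) B + q <= size B.
  have [a1 a2 a3 a4] := theta_ends_adj (theta_swap th).
  apply: (@gap_count _ _ _ u) => //; first by move/eqP; rewrite (negbTE Bn).
  move=> s1 x m y s2 EB; have := strand_gap (theta_swap th) _ EB; rewrite EQ.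
  by apply.
have us : uniq ([:: u, v & A ++ B] ++ [::]).
  by rewrite cats0; apply: (uniq_count_le ut) => w; count_lia.
have nil : {in [::], forall w : G, ~~ adj u w && ~~ adj v w} by [].
have := degree_sum_outer us nil.
rewrite -/q /= !count_cat size_cat !adj_irrefl (adj_sym v) (negbTE nuv).
by move: cA cB duv; rewrite /=; count_lia.
Qed.

Lemma chain_two (u v z1 z2 : G) Z A B : theta u v [:: z1, z2 & Z] A B ->
    count (adj z2) [:: u, v & A ++ B] <= 1 -> {in z2 :: Z, forall w, ~~ adj u w} ->
  chain_ok u v [:: z1, z2 & Z].
Proof.
move=> th c1 nZ; right; apply/negP; rewrite /= /oadj (negbTE (nZ z2 _)) ?inE ?eqxx //.
case/and3P=> _ _ duz; have o_sym := @oadj_sym G.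
have [ut pA pB pZ /and3P[_ An Bn] top] := th.
set s := [:: u, v & A ++ B] in c1.
have us : uniq (s ++ [:: z2]) by apply: (uniq_count_le ut) => w; rewrite /s; count_lia.
have [a1 a2 a3 a4] := theta_ends_adj th.
have [A1 [x [A2 [EA ux nA2]]]] :
    exists A1 x A2, [/\ A = rcons A1 x ++ A2, adj u x & ~~ has (adj u) A2].
  have hA : has (adj u) (rev A).
    apply/hasP; exists (head u A) => //.
    by rewrite mem_rev; case: (A) An => // a A' _; rewrite inE eqxx.
  rewrite -[A]revK; case/split_find: hA => x s1 s2 ux nA.
  exists (rev s2), x, (rev s1); split=> //; last by rewrite has_rev.
  by rewrite rev_cat rev_rcons cat_rcons.
have nz : {in [:: z2], forall w : G, ~~ adj u w && ~~ adj z2 w}.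
  by move=> w; rewrite inE => /eqP ->; rewrite adj_irrefl nZ // inE eqxx.
have q1 : size A2 < #|outer_common s u z2|.
  have := degree_sum_outer us nz.
  have : count (adj u) s <= (size A1 + size B).+2.
    rewrite /s EA /= adj_irrefl !count_cat -cats1 count_cat /= ux.
    move: nA2; rewrite has_count -leqNgt leqn0 => /eqP ->.
    have := count_size (adj u) A1; have := count_size (adj u) B.
    by have := leq_b1 (adj u v); clear; lia.
  have -> : size s = (size A1 + size A2 + size B).+3.
    by rewrite /s EA -cats1; count_lia.
  by move: c1 duz; count_lia.
pose Q := enum (outer_common s u z2).
have wQ := outer_path th (leq_ltn_trans (leq0n _) q1); rewrite -/s -/Q in wQ.
have QS w : w \in Q -> [/\ adj u w, adj z2 w & w \notin s].
  by rewrite mem_enum => /outer_commonP.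
have Qn : Q != [::] by rewrite -size_eq0 -cardE -lt0n (leq_ltn_trans _ q1).
have [hQ lQ] : head u Q \in Q /\ last u Q \in Q.
  by case: (Q) Qn => // a l _; rewrite inE eqxx /= mem_last.
have [b [B' EB]] : exists b B', B = b :: B' by case: (B) Bn => // b B' _; exists b, B'.
have [a [A' EA']] : exists a A', A = a :: A' by case: (A) An => // a A' _; exists a, A'.
have hub_u := theta_heads_oadj claw_heavy th.
have wB : walk (@oadj G) b B (last u B).
  rewrite EB; exists B'; split=> //; apply: oadj_path.
  by move: pB; rewrite EB /= rcons_path => /and3P[].
have w1 : walk (@oadj G) a (rcons A1 x) x.
  have : walk (@oadj G) a A (last u A).
    rewrite EA'; exists A'; split=> //; apply: oadj_path.
    by move: pA; rewrite EA' /= rcons_path => /and3P[].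
  rewrite EA; case: (A2) => [|c A2'].
    rewrite cats0 last_rcons; by case=> l [El pl ll]; exists l.
  by case/walk_uncat.
have wZ : walk (@oadj G) z2 (z2 :: Z) (last z2 Z).
  exists Z; split=> //; apply: oadj_path.
  by move: pZ; rewrite /= rcons_path => /and4P[].
have [c cc pc] : exists2 c, cycle (@oadj G) c &
    perm_eq c (u :: Q ++ z2 :: Z ++ v :: B ++ rcons A1 x).
  have W1 : walk (@oadj G) u (u :: Q) (last u Q).
    apply: walk_cat (walk1 _ u) _ wQ.
    by apply: adj_oadj; case: (QS _ hQ).
  have W2 : walk (@oadj G) u ((u :: Q) ++ z2 :: Z) (last z2 Z).
    apply: walk_cat W1 _ wZ.
    by apply: adj_oadj; rewrite adj_sym; case: (QS _ lQ).
  have zv : oadj (last z2 Z) v.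
    by apply: adj_oadj; move: pZ; rewrite /= rcons_path => /and4P[].
  have W3 := walk_rcons W2 zv.
  have vB : oadj v (last u B).
    by apply: adj_oadj; rewrite adj_sym; move: pB; rewrite rcons_path => /andP[].
  have W4 := walk_cat W3 vB (walk_rev o_sym wB).
  have ba : oadj b a by rewrite o_sym; move: hub_u; rewrite EA' EB.
  have := walk_cycle (m := [::]) (walk_cat W4 ba w1); rewrite cats0 => W5.
  eexists; first by apply: W5; rewrite /= adj_oadj // adj_sym.
  by apply/permP => k; rewrite -!cats1; count_lia.
have ucQ : uniq (([:: u, v & A ++ B] ++ z2 :: Z) ++ Q).
  rewrite cat_uniq enum_uniq andbT; apply/andP; split.
    by apply: (uniq_count_le ut) => w; count_lia.
  apply/hasPn => w /QS[uw _ ws]; change (w \notin s ++ z2 :: Z).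
  rewrite mem_cat negb_or ws /=.
  by apply: contraTN uw => /nZ.
have /top/(_ cc) : uniq c.
  rewrite (perm_uniq pc); apply: (uniq_count_le ucQ) => w.
  by rewrite EA -!cats1; count_lia.
rewrite (perm_size pc); move: q1; rewrite cardE -/Q EA; count_lia.
Qed.
End Chain.

Lemma max_nat_exists (P : nat -> Prop) N :
  (exists n, P n) -> (forall n, P n -> n <= N) ->
  exists m, P m /\ forall n, P n -> n <= m.
Proof.
move=> exP; elim: N => [|N IHN] leN.
  have [n Pn] := exP; have := leN n Pn; rewrite leqn0 => /eqP n0; subst n.
  by exists 0; split=> // n /leN.
have [PN | nPN] := classic (P N.+1); first by exists N.+1.
apply: IHN => n Pn; have := leN n Pn; rewrite leq_eqVlt => /predU1P[nN | //].
by subst n.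
Qed.

Lemma min_nat_exists (P : nat -> Prop) :
  (exists n, P n) -> exists m, P m /\ forall n, P n -> m <= n.
Proof.
move=> [n]; elim/ltn_ind: n => n IHn Pn.
have [[k [kn Pk]] | nk] := classic (exists k, k < n /\ P k); first exact: IHn kn Pk.
exists n; split=> // k Pk; rewrite leqNgt; apply/negP => kn; apply: nk.
by exists k.
Qed.

Lemma not_uniq_split (T : eqType) (s : seq T) : ~~ uniq s ->
  exists s1 w s2 s3, s = s1 ++ w :: s2 ++ w :: s3.
Proof.
elim: s => //= a s IHs; rewrite negb_and negbK => /orP[/splitPr[s2 s3] | /IHs].
  by exists [::], a, s2, s3.
by move=> [s1 [w [s2 [s3 ->]]]]; exists (a :: s1), w, s2, s3.
Qed.

Section TwoConnected.
Variable G : sgraph.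
Hypothesis G2 : k_connected 2 G.

Lemma third_vertex (x y : G) : exists z, z != x /\ z != y.
Proof.
have [G3 _] := G2.
have : 0 < #|~: [set x; y]|.
  by move: G3; rewrite -(cardsC [set x; y]) cards2; case: (x != y); rewrite ?ltnS; case: #|~: _|.
by case/card_gt0P => z; rewrite !inE negb_or => /andP[zx zy]; exists z.
Qed.

Lemma avoiding_path (w x y : G) : x != w -> y != w ->
  exists p, [/\ path (@adj G) x p, last x p = y & w \notin p].
Proof.
move=> xw yw; have [_ /(_ [set w])] := G2; rewrite cards1 => /(_ isT) [_ conn].
have xP : x \in ~: [set w] by rewrite !inE.
have yP : y \in ~: [set w] by rewrite !inE.
have /connectP[p pp lp] := conn (exist _ x xP) (exist _ y yP).
exists (map val p); split.
- by rewrite -[x]/(val (exist (fun x => x \in ~: [set w]) x xP)) path_map.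
- by rewrite -[x]/(val (exist (fun x => x \in ~: [set w]) x xP)) last_map -lp.
- by apply/mapP => -[z _ wz]; have := valP z; rewrite -wz !inE eqxx.
Qed.

Lemma vertices_path (x y : G) : exists p, path (@adj G) x p /\ last x p = y.
Proof.
have [w [wx wy]] := third_vertex x y.
have [|| p [pp lp _]] := @avoiding_path w x y; try by rewrite eq_sym.
by exists p.
Qed.

Lemma cycle_exists : exists c : seq G, [/\ uniq c, cycle (@adj G) c & 2 < size c].
Proof.
have [G3 _] := G2; have /card_gt0P[x _] : 0 < #|G| by apply: leq_trans G3.
have [y [yx _]] := third_vertex x x.
have [w1 xw1] : exists w1, adj x w1.
  have [[|w1 p] [/= pp lp]] := vertices_path x y; first by rewrite -lp eqxx in yx.
  by exists w1; case/andP: pp.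
have [y' [y'x y'w1]] := third_vertex x w1.
have [w2 [xw2 w21]] : exists w2, adj x w2 /\ w2 != w1.
  have [[|w2 p] [/= pp lp wp]] := @avoiding_path w1 x y' (adj_neq xw1) y'w1.
    by rewrite -lp eqxx in y'x.
  exists w2; split; first by case/andP: pp.
  by move: wp; rewrite inE negb_or eq_sym => /andP[].
have w1x : w1 != x by rewrite eq_sym adj_neq.
have w2x : w2 != x by rewrite eq_sym adj_neq.
have [p [pp lp xp]] := avoiding_path w1x w2x.
case/shortenP: pp lp => p' pp' up' sp' lp'.
exists (x :: w1 :: p'); split.
- rewrite cons_uniq up' andbT inE negb_or adj_neq //=.
  by apply: contra xp; apply: sp'.
- by rewrite /= xw1 rcons_path pp' lp' adj_sym.
- by case: p' lp' {pp' up' sp'} => //= E; rewrite E eqxx in w21.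
Qed.

Definition ear (c : seq G) (u v : G) Z :=
  [/\ u \in c, v \in c, u != v, path (@adj G) u (rcons Z v)
    & {in Z, forall w, w \notin c}].

Lemma ear_exists (c : seq G) z : uniq c -> 1 < size c -> z \notin c ->
  exists u v Z, ear c u v Z /\ 0 < size Z.
Proof.
move=> uc sc zc.
have first_on x p : x \notin c -> path (@adj G) x p -> last x p \in c ->
    exists s u s', [/\ p = rcons s u ++ s', u \in c, {in s, forall w, w \notin c}
                     & path (@adj G) x (rcons s u)].
  move=> xc pp lc; have hp : has (mem c) p.
    apply/hasP; exists (last x p) => //.
    by case: p lc {pp} => [|a p] lc; [rewrite (negbTE xc) in lc | rewrite /= mem_last].
  case/split_find: hp pp => u s s' uc' /hasPn ns pp; exists s, u, s'; split=> //.
  by move: pp; rewrite cat_path => /andP[].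
have [y [y' [yc yc' yy]]] : exists y y', [/\ y \in c, y' \in c & y != y'].
  case: c uc sc {zc first_on} => [|y [|y' c]] //= /andP[yn _] _.
  exists y, y'; rewrite !inE !eqxx !orbT; split=> //.
  by move: yn; rewrite inE negb_or => /andP[].
have [p [pp lp]] := vertices_path z y.
have [|s [u [s' [_ uc' ns ps]]]] := first_on _ _ zc pp; first by rewrite lp.
have [x [xc xu]] : exists x, x \in c /\ x != u.
  have [E | ] := eqVneq y u; last by exists y.
  by exists y'; split=> //; rewrite -E eq_sym.
have zu : z != u by apply: contraNneq zc => ->.
have [p2 [pp2 lp2 up2]] := avoiding_path zu xu.
have [|s2 [v [s2' [Ep2 vc ns2 ps2]]]] := first_on _ _ zc pp2; first by rewrite lp2.
exists u, v, (rev s ++ z :: s2); split; last by rewrite size_cat /= addnS.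
split=> //.
- by apply: contraNneq up2 => ->; rewrite Ep2 mem_cat mem_rcons inE eqxx.
- by rewrite path_split ps2 andbT -path_rev //; apply: adj_sym.
- by move=> w; rewrite mem_cat mem_rev inE => /or3P[/ns | /eqP -> | /ns2].
Qed.
End TwoConnected.

Lemma chain_of_shortest (G : sgraph) (u v : G) Z A B :
    graph_heavy claw G -> theta u v Z A B ->
    (1 < size Z -> forall w, w \notin [:: u, v & A ++ B] ->
       count (adj w) [:: u, v & A ++ B] <= 1) ->
    {in behead Z, forall w, ~~ adj u w} ->
  chain_ok u v Z.
Proof.
move=> claw_heavy th few far.
have [ut _ _ _ Zn _] := th.
case: Z Zn th ut few far => [|z1 [|z2 Z]] // _ th ut few far.
  exact: (chain_one claw_heavy th).
apply: (chain_two claw_heavy th) => //; apply: few => //.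
have : uniq (z2 :: [:: u, v & A ++ B]) by apply: (uniq_count_le ut) => w; count_lia.
by case/andP.
Qed.

Lemma heavy_hamiltonian (G : sgraph) :
  k_connected 2 G -> graph_heavy claw G -> graph_heavy wounded G -> hamiltonian G.
Proof.
move=> G2 claw_heavy wounded_heavy; apply: NNPP => nham.
pose cyc n := exists c : seq G, [/\ uniq c, cycle (@adj G) c & 2 < size c] /\ size c = n.
have [n [[c [[uc cc sc] cn]] max_n]] : exists n, cyc n /\ forall m, cyc m -> m <= n.
  apply: (@max_nat_exists _ #|G|).
    by have [c Hc] := cycle_exists G2; exists (size c), c.
  move=> m [c [[uc _ _] <-]]; rewrite -(card_uniqP uc); exact: max_card.
have maxc (d : seq G) : uniq d -> cycle (@adj G) d -> size d <= size c.
  move=> ud cd; have [sd | sd] := ltnP 2 (size d); last by apply: leq_trans sd (ltnW sc).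
  by rewrite cn; apply: max_n; exists d.
have [z zc] : exists z, z \notin c.
  apply: NNPP => nz; apply: nham; exists c; split=> //; first by rewrite /ucycle cc uc.
  by move=> x; apply: contraT => xc; case: nz; exists x.
have [m [[u [v [Z [[uc' vc uv pZ oZ] [Zm m0]]]]] min_m]] : exists m,
    (exists u v Z, ear c u v Z /\ (size Z = m /\ 0 < m)) /\
    forall k, (exists u v Z, ear c u v Z /\ (size Z = k /\ 0 < k)) -> m <= k.
  apply: min_nat_exists; have [u [v [Z [eZ Z0]]]] := ear_exists G2 uc (ltnW sc) zc.
  by exists (size Z), u, v, Z.
have short x y Y : ear c x y Y -> Y != [::] -> size Z <= size Y.
  move=> eY Yn; rewrite Zm; apply: min_m; exists x, y, Y; split=> //; split=> //.
  by rewrite lt0n size_eq0.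
have uZ : uniq Z.
  apply: contraT => /not_uniq_split[Z1 [w [Z2 [Z3 EZ]]]].
  have : size Z <= size (Z1 ++ w :: Z3).
    apply: (short u v); last by case: (Z1).
    split=> //.
      move: pZ; rewrite EZ path_split => /andP[p1]; rewrite path_split => /andP[_ p3].
      by rewrite path_split p1.
    by move=> x xZ; apply: oZ; rewrite EZ; move: xZ; rewrite !mem_cat !inE !mem_cat !inE => /or3P[->|->|->]; rewrite ?orbT.
  by rewrite EZ; count_lia.
have [i s rc] := rot_to uc'.
have us : uniq (u :: s) by rewrite -rc rot_uniq.
have pc : perm_eq (u :: s) c by rewrite -rc perm_rot.
have cs : cycle (@adj G) (u :: s) by rewrite -rc rot_cycle.
have vs : v \in s.
  by move: vc; rewrite -(perm_mem pc) inE eq_sym (negbTE uv).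
case/splitPr: vs => A B' in rc us pc cs.
move: cs; rewrite /= path_split => /andP[pA pB'].
pose B := rev B'.
have pB : path (@adj G) u (rcons B v) by rewrite -path_rev //; apply: adj_sym.
have pcAB : perm_eq [:: u, v & A ++ B] c.
  by apply: perm_trans pc; apply/permP => k; rewrite /B; count_lia.
have uAB : uniq [:: u, v & Z ++ A ++ B].
  have uc2 : uniq (c ++ Z).
    by rewrite cat_uniq uc uZ andbT /=; apply/hasPn => w /oZ.
  apply: (uniq_count_le uc2) => w; have /= := permP pcAB (pred1 w).
  by count_lia.
have sAB : size c = size A + size B + 2 by rewrite -(perm_size pcAB); count_lia.
have Zn : Z != [::] by rewrite -size_eq0 Zm -lt0n.
have th : theta u v Z A B.
  split=> //.
    rewrite Zn /=; apply/andP; split.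
      have : size (u :: Z ++ v :: rev B) <= size c.
        apply: maxc; first by apply: (uniq_count_le uAB) => w; count_lia.
        by rewrite /= path_split pZ -path_rev //; apply: adj_sym.
      rewrite sAB -!size_eq0; move: m0; rewrite -Zm; count_lia.
    have : size (u :: A ++ v :: rev Z) <= size c.
      apply: maxc; first by apply: (uniq_count_le uAB) => w; count_lia.
      by rewrite /= path_split pA -path_rev //; apply: adj_sym.
    rewrite sAB -!size_eq0; move: m0; rewrite -Zm; count_lia.
  move=> d ud cd; rewrite -sAB.
  have [sd | sd] := ltnP 2 (size d); last by apply: leq_trans sd (ltnW sc).
  have [d' [ud' cd' sd']] := long_adj_cycle (@oadj_sym G) (@adj_oadj G) (fun a b h => h) ud cd sd.
  exact: leq_trans sd' (maxc _ ud' cd').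
have few : 1 < size Z -> forall w, w \notin c -> count (adj w) c <= 1.
  move=> Z1 w wc; rewrite -size_filter leqNgt; apply/negP => s2.
  have uf := filter_uniq (adj w) uc.
  have memf a : a \in filter (adj w) c -> a \in c /\ adj w a.
    by rewrite mem_filter => /andP[].
  case E : (filter (adj w) c) s2 => [|a [|b f]] // _.
  have [ac wa] : a \in c /\ adj w a by apply: memf; rewrite E inE eqxx.
  have [bc wb] : b \in c /\ adj w b by apply: memf; rewrite E !inE eqxx orbT.
  have ab : a != b by move: uf; rewrite E /= inE negb_or => /andP[/andP[]].
  have : size Z <= size [:: w].
    apply: (short a b) => //; split=> //; last by move=> x; rewrite inE => /eqP ->.
    by rewrite /= adj_sym wa wb.
  by rewrite leqNgt Z1.
have eZ : ear c u v Z by [].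
have eZr : ear c v u (rev Z).
  split=> //; [by rewrite eq_sym | by rewrite -path_rev //; apply: adj_sym |].
  by move=> w; rewrite mem_rev; apply: oZ.
have far x y Y : ear c x y Y -> size Y <= size Z -> {in behead Y, forall w, ~~ adj x w}.
  move=> [xc yc xy pY oY] sY w wY; apply/negP => xw.
  case: Y wY pY oY sY => //= y1 Y /splitPr[Y1 Y2] pY oY sY.
  have : size Z <= size (w :: Y2).
    apply: (short x y) => //; split=> //.
      by move: pY; rewrite /= xw path_split => /and3P[].
    by move=> t tY; apply: oY; rewrite inE mem_cat tY !orbT.
  by move: sY; count_lia.
have cycP s' : perm_eq s' c -> 1 < size Z -> forall w, w \notin s' -> count (adj w) s' <= 1.
  move=> ps Z1 w; rewrite (perm_mem ps) => wc; have /= -> := permP ps (adj w).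
  exact: few.
apply: (@theta_chains_absurd G claw_heavy wounded_heavy u v Z A B th).
  apply: (chain_of_shortest claw_heavy th); first exact: cycP.
  exact: far eZ _.
apply: (chain_of_shortest claw_heavy (theta_rev th)).
  rewrite size_rev; apply: cycP; apply: perm_trans pcAB.
  by apply/permP => k; count_lia.
by apply: (far _ _ _ eZr); rewrite size_rev.
Qed.

Theorem theorem3 (G : sgraph) :
  k_connected 2 G -> family_heavy claw_or_wounded G -> hamiltonian G.
Proof.
move=> G2 H; apply: heavy_hamiltonian => //; apply: H; first by left.
by right.
Qed.
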